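(* Let $f:\mathbb{R}^d\to\mathbb{R}$, let ${\bm{x}}^\star$ be a local minimizer of $f$ with $f$ twice differentiable in a neighborhood of ${\bm{x}}^\star$, and let ${\bm{H}}:=\nabla^2 f({\bm{x}}^\star)$ satisfy ${\bm{H}}\succeq 0$, ${\bm{H}}\neq {\bm{0}}$, with eigenvalues $\lambda_1\ge\cdots\ge\lambda_d\ge 0$, $\lambda_{\max}({\bm{H}}):=\lambda_1$. Consider ZO-GD with step size $\eta>0$ and smoothing parameter $\mu>0$ applied to the quadratic model $f_{\mathrm{quad}}({\bm{x}})=f({\bm{x}}^\star)+\tfrac12({\bm{x}}-{\bm{x}}^\star)^\top{\bm{H}}({\bm{x}}-{\bm{x}}^\star)$, i.e. \[ {\bm{x}}_{t+1}={\bm{x}}_t-\eta\,\frac{f_{\mathrm{quad}}({\bm{x}}_t+\mu{\bm{u}}_t)-f_{\mathrm{quad}}({\bm{x}}_t-\mu{\bm{u}}_t)}{2\mu}\,{\bm{u}}_t,\qquad {\bm{u}}_t\overset{\mathrm{i.i.d.}}{\sim}\mathcal N({\bm{0}},{\bm{I}}_d). \] Then the critical step size in the mean is $\eta^\star_{\mathrm{mean}}=2/\lambda_{\max}({\bm{H}})$, and the mean-square critical step size $\eta^\star_{\mathrm{ms}}$ is the unique $\eta>0$ satisfying \[ \eta\lambda_{\max}({\bm{H}})<1\quad\text{and}\quad \sum_{i=1}^d\frac{\eta\lambda_i}{2(1-\eta\lambda_i)}=1, \] and it satisfies \[ \frac{2}{\Tr({\bm{H}})+2\lambda_{\max}({\bm{H}})}\le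 \eta^\star_{\mathrm{ms}}\le\frac{2}{\Tr({\bm{H}})}. \]
   Context: For an optimizer with step size $\eta$ applied to $f_{\mathrm{quad}}$ producing iterates $\{{\bm{x}}_t\}_{t\ge0}$, the critical step size in the mean is $\eta^\star_{\mathrm{mean}}:=\sup\{\eta>0:\ \forall {\bm{x}}_0\in\mathbb{R}^d,\ \sup_{t\ge0}\|\mathbb{E}[{\bm{x}}_t-{\bm{x}}^\star]\|<\infty\}$ and the mean-square critical step size is $\eta^\star_{\mathrm{ms}}:=\sup\{\eta>0:\ \forall {\bm{x}}_0\in\mathbb{R}^d,\ \sup_{t\ge0}\mathbb{E}\|{\bm{x}}_t-{\bm{x}}^\star\|^2<\infty\}$. *)

(* Defs.v *)
From HB Require Import structures.
From mathcomp Require Import all_boot all_order all_algebra.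
From mathcomp Require Import all_classical all_reals all_analysis.
Set Implicit Arguments. Unset Strict Implicit. Unset Printing Implicit Defensive.
Import Order.TTheory GRing.Theory Num.Theory.
Import numFieldNormedType.Exports.
Local Open Scope classical_set_scope.
Local Open Scope ring_scope.

Section Defs.
Context {R : realType}.

Definition fquad (n : nat) (H : 'M[R]_n) (xstar : 'rV[R]_n) (fstar : R)
  (x : 'rV[R]_n) : R :=
  fstar + 2^-1 * ((x - xstar) *m H *m (x - xstar)^T) ord0 ord0.

Fixpoint zogd (n : nat) (F : 'rV[R]_n -> R) (eta mu : R)
  (u : nat -> 'rV[R]_n) (x0 : 'rV[R]_n) (t : nat) : 'rV[R]_n :=
  match t with
  | 0 => x0
  | t'.+1 => let x := zogd F eta mu u x0 t' in
      x - (eta * ((F (x + mu *: u t') - F (x - mu *: u t')) / (2 * mu))) *: u t'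
  end.

Definition Hessian (n : nat) (f : 'rV[R]_n -> R) (x : 'rV[R]_n) : 'M[R]_n :=
  \matrix_(i, j) ('D_(delta_mx ord0 i) ('D_(delta_mx ord0 j) f) x).

Definition twice_differentiable_near (n : nat) (f : 'rV[R]_n -> R) (x0 : 'rV[R]_n) :=
  \forall x \near x0, differentiable f x /\
     (forall v : 'rV[R]_n, differentiable ('D_v f) x).

Definition local_minimizer (n : nat) (f : 'rV[R]_n -> R) (x0 : 'rV[R]_n) :=
  \forall x \near x0, f x0 <= f x.

Definition psd (n : nat) (H : 'M[R]_n) :=
  H^T = H /\ forall v : 'rV[R]_n, 0 <= (v *m H *m v^T) ord0 ord0.

Definition sorted_eigenvalues (n : nat) (H : 'M[R]_n) (lam : 'I_n -> R) :=
  char_poly H = \prod_(i < n) ('X - (lam i)%:P) /\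
  forall i j : 'I_n, (i <= j)%N -> lam j <= lam i.

Definition lambda_max (n : nat) (lam : 'I_n -> R) : R := \big[Num.max/0]_(i < n) lam i.

Section Prob.
Context {dT : measure_display} {T : measurableType dT} (P : probability T R).

Definition std_normal (X : T -> R) :=
  measurable_fun setT X /\
  forall A : set R, measurable A -> P (X @^-1` A) = normal_prob 0 1 A.

Definition mutually_independent (I : eqType) (X : I -> T -> R) :=
  forall (s : seq I) (B : I -> set R), uniq s -> (forall i, measurable (B i)) ->
    P [set w | forall i, i \in s -> B i (X i w)] = (\prod_(i <- s) P (X i @^-1` B i))%E.

(* u_t = \row_i g t i, with all coordinates (t, i) i.i.d. N(0,1): u_t iid N(0, I_n) *)
Definition iid_std_gaussian_vectors (n : nat) (g : nat -> 'I_n -> T -> R) :=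
  mutually_independent (fun ti : nat * 'I_n => g ti.1 ti.2) /\
  forall t i, std_normal (g t i).

Definition dirs (n : nat) (g : nat -> 'I_n -> T -> R) (w : T) : nat -> 'rV[R]_n :=
  fun t => \row_i g t i w.

Definition zo_err (n : nat) (H : 'M[R]_n) (xstar : 'rV[R]_n) (fstar eta mu : R)
  (g : nat -> 'I_n -> T -> R) (x0 : 'rV[R]_n) (t : nat) (w : T) : 'rV[R]_n :=
  zogd (fquad H xstar fstar) eta mu (dirs g w) x0 t - xstar.

Definition stable_in_mean (n : nat) (H : 'M[R]_n) xstar fstar eta mu g :=
  forall x0 : 'rV[R]_n, exists M : R, forall t : nat,
    Num.sqrt (\sum_(i < n) (fine ('E_P[fun w => zo_err H xstar fstar eta mu g x0 t w ord0 i])) ^+ 2)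
      <= M.

Definition stable_in_ms (n : nat) (H : 'M[R]_n) xstar fstar eta mu g :=
  forall x0 : 'rV[R]_n, exists M : R, forall t : nat,
    ('E_P[fun w => (\sum_(i < n) (zo_err H xstar fstar eta mu g x0 t w ord0 i) ^+ 2)%R]
      <= M%:E)%E.

Definition eta_crit_mean (n : nat) (H : 'M[R]_n) xstar fstar mu g : R :=
  sup [set eta : R | 0 < eta /\ stable_in_mean H xstar fstar eta mu g].

Definition eta_crit_ms (n : nat) (H : 'M[R]_n) xstar fstar mu g : R :=
  sup [set eta : R | 0 < eta /\ stable_in_ms H xstar fstar eta mu g].

End Prob.
End Defs.

(* Main.v *)
Require Import Defs.
From HB Require Import structures.
From mathcomp Require Import all_boot all_order all_algebra.
From mathcomp Require Import all_classical all_reals all_analysis.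
From mathcomp Require Import measurable_realfun ring lra.
Set Implicit Arguments. Unset Strict Implicit. Unset Printing Implicit Defensive.
Import Order.TTheory GRing.Theory Num.Theory.
Import numFieldNormedType.Exports.
Local Open Scope classical_set_scope.
Local Open Scope ring_scope.

(** On a quadratic the central difference is exact, so the error obeys
    [e' = e - eta (e H u^T) u].  In an orthonormal eigenbasis of [H] the means of the
    coordinates are multiplied by [1 - eta lam_j] at every step, and Wick's formula gives for
    the second moments the closed recursion
      [s'_j = (1 - 2 eta lam_j + 2 (eta lam_j)^2) s_j + eta^2 sum_k lam_k^2 s_k].
    With the weights [W_j = lam_j / (1 - eta lam_j)] and [S = sum_j eta lam_j / (2 (1 - eta lam_j))]
    one has [sum_j W_j s'_j = sum_j W_j s_j + 2 eta (S - 1) sum_k lam_k^2 s_k]: below [S = 1] this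
    weighted sum pays for the growth of the unweighted one, above [S = 1] it grows geometrically.
    The iterates being polynomials in finitely many independent Gaussians, independence is only
    needed in the form: the expectation of a monomial is the product of one-dimensional
    moments. *)

(** * Orthogonal diagonalization of a symmetric matrix with split characteristic polynomial *)

(** Independence is assumed for events on single coordinates, one per variable, whereas the
    recursions need it between a whole iterate and the next direction. Polynomials bridge the gap:
    every iterate is a finite combination of monomials in the coordinates drawn so far, each of them
    integrable, so expectations split term by term and a monomial in new coordinates factors out.
    The function [S] has a pole at [eta = 1 / lam_max], beyond which some weights [W_j] turn
    negative. Divergence there is read off the top coordinate alone, whose second moment at least
    doubles at every step. Both critical sizes being suprema, behaviour at the critical value itself
    never has to be decided. *)

Lemma mx11E (R : pzRingType) (A B : 'M[R]_1) : A ord0 ord0 = B ord0 ord0 -> A = B.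
Proof. by move=> AB; apply/matrixP => i j; rewrite !ord1. Qed.

Lemma dot_row_gt0 (R : realDomainType) n (v : 'rV[R]_n) : v != 0 -> 0 < (v *m v^T) ord0 ord0.
Proof.
move=> v0; rewrite mxE lt_neqAle sumr_ge0 ?andbT; last first.
  by move=> i _; rewrite mxE -expr2 sqr_ge0.
apply: contra v0 => /eqP/esym/eqP; rewrite psumr_eq0 => [/allP h|i _]; last first.
  by rewrite mxE -expr2 sqr_ge0.
apply/eqP/rowP => i; have := h i (mem_index_enum _).
by rewrite !mxE -expr2 sqrf_eq0 => /eqP.
Qed.

Lemma householder_orthogonal (R : fieldType) n (w : 'rV[R]_n) (c : R) :
  c != 0 -> w *m w^T = c%:M ->
  (1%:M - (2 / c) *: (w^T *m w)) *m (1%:M - (2 / c) *: (w^T *m w))^T = 1%:M.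
Proof.
move=> c0 ww.
have -> : (1%:M - (2 / c) *: (w^T *m w))^T = 1%:M - (2 / c) *: (w^T *m w).
  rewrite [LHS]raddfB /= trmx1; congr (_ - _).
  by rewrite [LHS]linearZ /= trmx_mul trmxK.
rewrite mulmxBl mul1mx mulmxBr mulmx1 -scalemxAl -scalemxAr -mulmxA (mulmxA w) ww.
rewrite mul_scalar_mx -scalemxAr !scalerA opprB -addrA.
rewrite -!scaleNr -!scalerDl [X in X *: _](_ : _ = 0) ?scale0r ?addr0//.
by field.
Qed.

(* The matrix is the Householder reflection exchanging the first basis vector and [v]. *)
Lemma orthogonal_completion (R : realFieldType) n (v : 'rV[R]_n.+1) :
  v *m v^T = 1%:M -> exists U : 'M[R]_n.+1, U *m U^T = 1%:M /\ row ord0 U = v.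
Proof.
move=> v1; pose e : 'rV[R]_n.+1 := delta_mx 0 0; pose w := e - v.
have [w0|w0] := eqVneq w 0.
  exists 1%:M; rewrite trmx1 mulmx1; split => //.
  by rewrite row1; apply/eqP; rewrite -subr_eq0; apply/eqP.
pose c := (w *m w^T) ord0 ord0; have c0 : 0 < c by apply: dot_row_gt0.
have wwE : w *m w^T = c%:M by apply: mx11E; rewrite !mxE eqxx mulr1n /c mxE.
exists (1%:M - (2 / c) *: (w^T *m w)); split; first by apply: householder_orthogonal; rewrite ?gt_eqF.
have ee : e *m e^T = 1%:M.
  by apply: mx11E; rewrite /e trmx_delta mul_delta_mx !mxE.
(* Both [e] and [v] are unit vectors, so [|e - v|^2 = 2 - 2 <e, v> = 2 <e, e - v>]; this makes the
   reflection send [e] to [e - w = v]. *)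
have ce : c = 2 * (e *m w^T) ord0 ord0.
  rewrite /c /w linearB /= mulmxBl !mulmxBr ee v1 !mxE.
  rewrite [X in _ - (X - _)](_ : _ = \sum_j e ord0 j * v^T j ord0); last first.
    by apply: eq_bigr => i _; rewrite !mxE mulrC.
  ring.
rewrite rowE -/e mulmxBr mulmx1 -scalemxAr mulmxA.
rewrite [e *m w^T](_ : _ = ((e *m w^T) ord0 ord0)%:M); last first.
  by apply: mx11E; rewrite !mxE eqxx mulr1n.
rewrite mul_scalar_mx scalerA [X in X *: _](_ : _ = 1) ?scale1r.
  by rewrite /w opprB addrC subrK.
by move: c0; rewrite ce => c0; field; rewrite gt_eqF //; nra.
Qed.

Lemma char_poly_orthogonal (R : comUnitRingType) n (U A : 'M[R]_n) :
  U *m U^T = 1%:M -> char_poly (U *m A *m U^T) = char_poly A.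
Proof.
move=> UU; have UU' : U^T *m U = 1%:M by apply: mulmx1C.
rewrite /char_poly; pose V := map_mx (@polyC R) U.
have VV : V *m V^T = 1%:M by rewrite /V (map_trmx _ U) -map_mxM UU map_mx1.
have -> : char_poly_mx (U *m A *m U^T) = V *m char_poly_mx A *m V^T.
  rewrite /char_poly_mx !map_mxM -(map_trmx _ U) -/V mulmxBr mulmxBl; congr (_ - _).
  by rewrite mul_mx_scalar -scalemxAl VV scale_scalar_mx mulr1.
rewrite !det_mulmx mulrAC -det_mulmx VV det1 mul1r //.
Qed.

Lemma char_poly_block_diag (R : comNzRingType) m n (A : 'M[R]_m) (B : 'M[R]_n) :
  char_poly (block_mx A 0 0 B) = char_poly A * char_poly B.
Proof. by rewrite /char_poly char_block_diag_mx det_ublock. Qed.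

(** Deflation. A unit eigenvector for [lam ord0] is completed to an orthogonal [U]; after
    conjugation the first row is a multiple of the first basis vector, and symmetry clears the first
    column. Cancelling ['X - lam ord0] leaves the factorization of the remaining block, so the
    diagonal comes out in the order of [lam]. *)
Lemma spectral_split (R : rcfType) n (H : 'M[R]_n) (lam : 'I_n -> R) :
  H^T = H -> char_poly H = \prod_(i < n) ('X - (lam i)%:P) ->
  exists Q : 'M[R]_n, Q *m Q^T = 1%:M /\ Q *m H *m Q^T = diag_mx (\row_i lam i).
Proof.
elim: n H lam => [|n IHn] H lam Hs chH.
  by exists 1%:M; split; apply/matrixP => -[].
have /eigenvalueP[v0 v0H v0n] : eigenvalue H (lam ord0).
  by rewrite eigenvalue_root_char chH big_ord_recl rootM root_XsubC eqxx.
pose c := (v0 *m v0^T) ord0 ord0; have c0 : 0 < c by apply: dot_row_gt0.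
pose v := (Num.sqrt c)^-1 *: v0.
have sc0 : Num.sqrt c != 0 by rewrite gt_eqF ?sqrtr_gt0.
have vH : v *m H = lam ord0 *: v by rewrite /v -scalemxAl v0H !scalerA mulrC.
have vv : v *m v^T = 1%:M.
  apply: mx11E; rewrite /v -scalemxAl linearZ /= -scalemxAr scalerA mxE -/c mxE eqxx mulr1n.
  by rewrite -expr2 exprVn sqr_sqrtr ?ltW// mulVf ?gt_eqF.
have [U [UU rU]] := orthogonal_completion vv.
pose H' : 'M[R]_(1 + n) := U *m H *m U^T.
have H's : H'^T = H' by rewrite /H' !trmx_mul trmxK Hs mulmxA.
have rH' : row ord0 H' = lam ord0 *: delta_mx 0 0.
  rewrite /H' -mulmxA row_mul rU mulmxA vH -scalemxAl -{1}rU -row_mul UU row1 //.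
have H'def : H' = U *m H *m U^T by [].
clearbody H'.
have H'E : H' = block_mx (lam ord0)%:M 0 0 (drsubmx H').
  rewrite -{1}(submxK H'); congr block_mx.
  - apply: mx11E; have /rowP/(_ ord0) := rH'; rewrite !mxE /= !lshift0 => ->.
    by rewrite mulr1.
  - apply/matrixP => i j; rewrite ord1; have /rowP/(_ (rshift 1 j)) := rH'.
    by rewrite !mxE lshift0 => ->; rewrite mulr0.
  - apply/matrixP => i j; rewrite ord1; have /rowP/(_ (rshift 1 i)) := rH'.
    by rewrite !mxE => h; rewrite -H's mxE lshift0 h mulr0.
have [||G [GG GH]] := IHn (drsubmx H') (fun i => lam (lift ord0 i)).
- by rewrite trmx_drsub H's.
- have := char_poly_orthogonal H UU; rewrite -H'def H'E chH big_ord_recl.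
  rewrite (@char_poly_block_diag _ 1 n).
  rewrite [X in X * _](_ : _ = 'X - (lam ord0)%:P); last first.
    by rewrite char_poly_trig ?scalar_mx_is_trig// big_ord1 mxE eqxx.
  by rewrite block_mxKdr => /mulfI; apply; rewrite polyXsubC_eq0.
pose B : 'M[R]_(1 + n) := block_mx 1%:M 0 0 G.
have BB : B *m B^T = 1%:M.
  rewrite /B tr_block_mx !trmx0 trmx1 mulmx_block.
  by rewrite !mulmx0 !mul0mx !addr0 !add0r mulmx1 GG -scalar_mx_block.
have BH : B *m H' *m B^T = diag_mx (\row_i lam i).
  rewrite H'E /B tr_block_mx !trmx0 trmx1 !mulmx_block.
  rewrite !mulmx0 !mul0mx !addr0 !add0r mulmx1 mul1mx GH.
  rewrite -[RHS](@submxK _ 1 n 1 n); congr block_mx; apply/matrixP => i j; rewrite !mxE.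
  - by rewrite !ord1 eqxx !lshift0.
  - by rewrite big1 ?ord1 // => k _; rewrite mxE mul0r.
  - rewrite big1 => [|k _]; last by rewrite mxE mul0r.
    by case: eqP => // /(congr1 val) /=; rewrite ord1.
  - have -> : rshift 1 i = lift ord0 i by apply: val_inj.
    by congr (_ *+ nat_of_bool _); apply/eqP/eqP => [->|/(congr1 val)[] /val_inj].
exists (B *m U); split; first by rewrite trmx_mul mulmxA -(mulmxA B) UU mulmx1.
by rewrite trmx_mul -BH H'def !mulmxA.
Qed.

(** * Integration against the image of a measure with density *)

Section density_transport.
Local Open Scope ereal_scope.
Context d d' (T : measurableType d) (S : measurableType d') (R : realType).
Variables (m : {measure set T -> \bar R}) (nu : {measure set S -> \bar R}).
Variables (X : T -> S) (Y : T -> R).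
Hypotheses (mX : measurable_fun setT X) (mY : measurable_fun setT Y).
Hypothesis Y0 : forall x, (0 <= Y x)%R.
Hypothesis XY : forall A, measurable A -> \int[m]_(x in X @^-1` A) (Y x)%:E = nu A.

Import HBNNSimple.

(** Simple functions and monotone convergence extend [XY] from sets to functions. It serves twice:
    with [Y] the product of the other independent factors and an indicator, and with [X] the
    identity and [Y] the Gaussian density. *)
Lemma ge0_integral_density (f : S -> \bar R) :
  (forall y, 0 <= f y) -> measurable_fun setT f ->
  \int[m]_x (f (X x) * (Y x)%:E) = \int[nu]_y f y.
Proof.
move=> f0 mf; have mT : measurable [set: S] by [].
have mE : measurable_fun setT (EFin \o Y) by exact/measurable_EFinP.
pose h := nnsfun_approx mT mf.
have -> : \int[nu]_y f y = limn (fun n => \int[nu]_y (h n y)%:E).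
  rewrite -monotone_convergence//=.
  - apply: eq_integral => x _; apply/esym/cvg_lim => //=.
    exact: cvg_nnsfun_approx.
  - by move=> n; exact/measurable_EFinP/measurable_funTS.
  - by move=> n x _; rewrite lee_fin.
  - by move=> x _ a b ab; rewrite lee_fin; exact/lefP/nd_nnsfun_approx.
have -> : \int[m]_x (f (X x) * (Y x)%:E) =
    limn (fun n => \int[m]_x ((h n (X x))%:E * (Y x)%:E)).
  rewrite -monotone_convergence//=.
  - apply: eq_integral => x _; apply/esym/cvg_lim => //=.
    apply: cvgeZr => //; exact: cvg_nnsfun_approx.
  - move=> n; apply: emeasurable_funM => //; apply/measurable_EFinP.
    by apply: measurableT_comp.
  - by move=> n x _; rewrite mule_ge0 ?lee_fin.
  - move=> x _ a b ab; rewrite lee_wpmul2r ?lee_fin//.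
    exact/lefP/nd_nnsfun_approx.
congr (limn _); apply/funext => n.
transitivity (\int[m]_x (\sum_(r \in range (h n))
    (r * \1_(h n @^-1` [set r]) (X x))%:E * (Y x)%:E)).
  apply: eq_integral => x _; rewrite -ge0_mule_fsuml => [|r].
    by rewrite fsumEFin// -fimfunE.
  exact: nnfun_muleindic_ge0.
transitivity (\int[nu]_y (\sum_(r \in range (h n))
    (r * \1_(h n @^-1` [set r]) y)%:E)); last first.
  by apply: eq_integral => y _; rewrite fsumEFin// -fimfunE.
have mP r : measurable (h n @^-1` [set r]) by [].
have mPX r : measurable (X @^-1` (h n @^-1` [set r])).
  by rewrite -[_ @^-1` _]setTI; exact: mX.
rewrite !ge0_integral_fsum//=; last 4 first.
- by move=> r; exact/measurable_EFinP/measurable_funM.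
- by move=> r x _; exact: nnfun_muleindic_ge0.
- move=> r; apply: emeasurable_funM => //; apply/measurable_EFinP.
  by apply: measurable_funM => //; apply: measurableT_comp.
- by move=> r x _; rewrite mule_ge0 ?lee_fin//; exact: nnfun_muleindic_ge0.
apply: eq_fsbigr => r; rewrite inE => -[y _ <-].
under [RHS]eq_integral do rewrite EFinM.
rewrite integralZl_indic_nnsfun//= integral_indic// setIT.
under eq_integral do rewrite EFinM -muleA.
rewrite ge0_integralZl//.
- congr (_ * _); rewrite -XY// [RHS]integral_mkcond; apply: eq_integral => x _.
  by rewrite epatch_indic muleC /= !indicE.
- apply: emeasurable_funM => //; apply/measurable_EFinP.
  by apply: measurableT_comp.
- by move=> x _; rewrite mule_ge0 ?lee_fin.
- by rewrite lee_fin.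
Qed.

End density_transport.

(** * Expectations of products of independent variables *)

Section independent_products.
Context dT (T : measurableType dT) (R : realType) (P : probability T R).
Variables (I : eqType) (X : I -> T -> R) (nu : probability (measurableTypeR R) R).
Hypothesis mX : forall i, measurable_fun setT (X i).
Hypothesis lawX : forall i (A : set R), measurable A -> P (X i @^-1` A) = nu A.
Hypothesis indX : mutually_independent P X.

Lemma measurable_prod_comp (s : seq I) (f : I -> R -> R) :
  (forall i, measurable_fun setT (f i)) ->
  measurable_fun setT (fun w => \prod_(i <- s) f i (X i w)).
Proof.
move=> mf; elim: s => [|k s IH].
  by under eq_fun do rewrite big_nil; exact: measurable_cst.
under eq_fun do rewrite big_cons; apply: measurable_funM => //.
exact: measurableT_comp.
Qed.

Lemma measurable_cylinder (s : seq I) (B : I -> set R) :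
  (forall i, measurable (B i)) ->
  measurable [set w | forall i, i \in s -> B i (X i w)].
Proof.
move=> mB; elim: s => [|k s IH].
  by rewrite (_ : [set _ | _] = setT)//; apply/seteqP; split.
rewrite (_ : [set _ | _] = X k @^-1` B k `&` [set w | forall i, i \in s -> B i (X i w)]).
  by apply: measurableI => //; rewrite -[_ @^-1` _]setTI; exact: mX.
apply/seteqP; split => [w h|w [hk h] i] /=.
  by split => [|i si]; apply: h; rewrite inE ?eqxx// si orbT.
by rewrite inE => /predU1P[->//|]; exact: h.
Qed.

(* Induction on [s1]: [ge0_integral_density] upgrades the indicator of one variable to a
   nonnegative function, the remaining indicators being the induction parameter [B]. *)
Lemma ge0_integral_indep_prod (s1 s2 : seq I) (f : I -> R -> R) (B : I -> set R) :
  uniq (s1 ++ s2) ->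
  (forall i, measurable_fun setT (f i)) -> (forall i x, 0 <= f i x) ->
  (forall i, nu.-integrable setT (EFin \o f i)) -> (forall i, measurable (B i)) ->
  (\int[P]_(w in [set w | forall i, i \in s2 -> B i (X i w)])
    (\prod_(i <- s1) f i (X i w))%:E =
  (\prod_(i <- s1) \int[nu]_x f i x)%:E * \prod_(i <- s2) nu (B i))%E.
Proof.
move=> + mf f0 If; elim: s1 s2 B => [|k s1 IH] s2 B us mB.
  under eq_integral do rewrite big_nil.
  rewrite big_nil mul1e integral_cst ?mul1e; last exact: measurable_cylinder.
  by apply: (etrans (indX us mB)); apply: eq_bigr => i _; exact: lawX.
move: us; rewrite cat_cons cons_uniq mem_cat negb_or => /andP[/andP[ks1 ks2] us].
set D := [set w | _]; have mD : measurable D by exact: measurable_cylinder.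
set q := (\prod_(i <- s2) nu (B i))%E.
have [p p0 qE] : exists2 p : R, 0 <= p & q = p%:E.
  rewrite /q; elim: s2 {us ks2 D mD q} => [|i s2 [p p0 E]].
    by exists 1; rewrite // big_nil.
  have fi : nu (B i) \is a fin_num by apply: (@fin_num_measure _ _ _ nu); exact: mB.
  exists (fine (nu (B i)) * p); first by rewrite mulr_ge0// fine_ge0.
  by rewrite big_cons E EFinM fineK.
have c0 : 0 <= (\prod_(i <- s1) \int[nu]_x f i x) * p.
  by rewrite mulr_ge0// prodr_ge0// => i _; apply: Rintegral_ge0.
pose c := NngNum c0.
pose Y w := (\prod_(i <- s1) f i (X i w)) * \1_D w.
have mY : measurable_fun setT Y.
  by apply: measurable_funM; [exact: measurable_prod_comp|exact: measurable_indic].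
have Y0 w : 0 <= Y w by rewrite mulr_ge0// prodr_ge0.
have XY A : measurable A ->
    (\int[P]_(w in X k @^-1` A) (Y w)%:E = mscale c nu A)%E.
  move=> mA; pose B' i := if i == k then A else B i.
  have := IH (k :: s2) B'; rewrite uniq_catC cons_uniq mem_cat negb_or ks1 ks2 uniq_catC us.
  move=> /(_ isT) H; rewrite big_cons {3}/B' eqxx in H.
  rewrite /mscale /= EFinM -qE.
  rewrite -muleA [(q * _)%E]muleC.
  transitivity (\int[P]_(w in X k @^-1` A `&` D) (\prod_(i <- s1) f i (X i w))%:E)%E.
    rewrite integral_mkcondr; apply: eq_integral => w _.
    by rewrite epatch_indic /Y EFinM.
  have -> : X k @^-1` A `&` D = [set w | forall i, i \in k :: s2 -> B' i (X i w)].
    apply/seteqP; split => [w [hA hD] i|w h] /=.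
      rewrite inE /B'; case: eqVneq => [->//|_ /=]; exact: hD.
    split; first by have := h k; rewrite inE eqxx /B' eqxx; apply.
    move=> i si; have /negbTE ik : i != k by apply: contraNneq ks2 => <-.
    by have := h i; rewrite inE si orbT /B' ik; apply.
  rewrite H; last by move=> i; rewrite /B'; case: ifP.
  congr (_ * (_ * _))%E; apply: eq_big_seq => i si; rewrite /B'.
  by have /negbTE -> : i != k by apply: contraNneq ks2 => <-.
have fk0 y : (0 <= (EFin \o f k) y)%E by rewrite lee_fin.
have mfk : measurable_fun setT (EFin \o f k) by exact/measurable_EFinP.
have := @ge0_integral_density _ _ T (measurableTypeR R) R P (mscale c nu)
  (X k) Y (mX k) mY Y0 XY _ fk0 mfk.
rewrite ge0_integral_mscale// => H.
rewrite [in RHS]big_cons qE -EFinM.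
rewrite [X in X%:E](_ : _ = c%:num * \int[nu]_x f k x); last by rewrite /=; ring.
rewrite EFinM {1}/Rintegral fineK ?integrable_fin_num//. apply: etrans H.
rewrite [LHS]integral_mkcond; apply: eq_integral => w _.
by rewrite epatch_indic /Y /= -!EFinM big_cons mulrA.
exact: If.
Qed.

Lemma integrable_measurable_fun (h : R -> R) :
  nu.-integrable setT (EFin \o h) -> measurable_fun setT h.
Proof. by move=> /integrableP[/measurable_EFinP]. Qed.

(** The nonnegative formula, applied to the absolute values with no events left, gives a finite
    product of finite integrals. *)
Lemma integrable_indep_prod (s : seq I) (f : I -> R -> R) :
  uniq s -> (forall i, nu.-integrable setT (EFin \o f i)) ->
  P.-integrable setT (fun w => (\prod_(i <- s) f i (X i w))%:E).
Proof.
move=> us If; have mf i : measurable_fun setT (f i).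
  exact: integrable_measurable_fun.
apply/integrableP; split.
  exact/measurable_EFinP/measurable_prod_comp.
under eq_integral do rewrite /= normr_prod.
have := @ge0_integral_indep_prod s [::] (fun i x => `|f i x|) (fun=> setT).
rewrite cats0 us big_nil mule1 => /(_ isT) H.
rewrite (_ : [set w | _] = setT) in H; last by apply/seteqP; split.
rewrite H ?ltry// => i.
- by apply: measurableT_comp.
- by have /= := integrable_abse (If i).
Qed.

(** Both sides are multilinear in the factors. Each signed factor is split as [|f| - (|f| - f)], a
    difference of nonnegative integrable functions, and passes from [s1] to the list [s2] of factors
    already nonnegative. *)
Lemma Rintegral_indep_prod (s : seq I) (f : I -> R -> R) :
  uniq s -> (forall i, nu.-integrable setT (EFin \o f i)) ->
  \int[P]_w (\prod_(i <- s) f i (X i w)) = \prod_(i <- s) \int[nu]_x f i x.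
Proof.
suff H s1 : forall s2 f, uniq (s1 ++ s2) ->
    (forall i, nu.-integrable setT (EFin \o f i)) ->
    (forall i x, i \in s2 -> 0 <= f i x) ->
  \int[P]_w (\prod_(i <- s1 ++ s2) f i (X i w)) = \prod_(i <- s1 ++ s2) \int[nu]_x f i x.
  by move=> us If; rewrite -[s]cats0; apply: H; rewrite ?cats0.
elim: s1 => [|k s1 IH] s2 {}f us If f0.
  have mf i : measurable_fun setT (f i).
    exact: integrable_measurable_fun.
  (* The nonnegative formula asks for a sign at every index, which is known on [s2] only; elsewhere
     the function is set to 0. *)
  pose f' i := if i \in s2 then f i else cst 0.
  have := @ge0_integral_indep_prod s2 [::] f' (fun=> setT).
  rewrite cats0 us big_nil mule1 => /(_ isT) H.
  rewrite (_ : [set w | _] = setT) in H; last by apply/seteqP; split.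
  rewrite /= [LHS]/Rintegral.
  transitivity (fine (\int[P]_w (\prod_(i <- s2) f' i (X i w))%:E)%E).
    congr fine; apply: eq_integral => w _; congr EFin.
    by apply: eq_big_seq => i si; rewrite /f' si.
  rewrite H /=.
  - by apply: eq_big_seq => i si; rewrite /f' si.
  - by move=> i; rewrite /f'; case: ifP => _; [exact: mf|exact: measurable_cst].
  - by move=> i x; rewrite /f'; case: ifP => [/f0|//]; exact.
  - by move=> i; rewrite /f'; case: ifP => _; [exact: If|exact: integrable0].
  - by [].
move: us; rewrite cat_cons cons_uniq mem_cat negb_or => /andP[/andP[ks1 ks2] us].
have us' : uniq (s1 ++ k :: s2).
  by rewrite uniq_catC cons_uniq mem_cat negb_or ks1 ks2 uniq_catC us.
pose F (h : R -> R) i := if i == k then h else f i.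
(* Here [a] is either evaluation at [X i w] or integration against [nu]: one identity isolates the
   factor [k] on both sides of the claim. *)
have FE h (a : (R -> R) -> I -> R) : \prod_(i <- s1 ++ k :: s2) a (F h i) i =
    a h k * \prod_(i <- s1 ++ s2) a (f i) i.
  rewrite !big_cat big_cons /= {2}/F eqxx mulrCA; congr (_ * (_ * _)).
    by apply: eq_big_seq => i si; rewrite /F ifN//; apply: contraNneq ks1 => <-.
  by apply: eq_big_seq => i si; rewrite /F ifN//; apply: contraNneq ks2 => <-.
pose h1 x := `|f k x|; pose h2 x := `|f k x| - f k x.
have Ih1 : nu.-integrable setT (EFin \o h1) by have /= := integrable_abse (If k).
have Ih2 : nu.-integrable setT (EFin \o h2) by have /= := integrableB measurableT Ih1 (If k).
have IF h : nu.-integrable setT (EFin \o h) -> forall i, nu.-integrable setT (EFin \o F h i).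
  by move=> Ih i; rewrite /F; case: ifP.
have F0 h : (forall x, 0 <= h x) -> forall i x, i \in k :: s2 -> 0 <= F h i x.
  by move=> h0 i x; rewrite inE /F; case: eqVneq => // _ /f0; apply.
have h10 x : 0 <= h1 x by exact: normr_ge0.
have h20 x : 0 <= h2 x by rewrite subr_ge0 ler_norm.
have E1 := IH _ _ us' (IF _ Ih1) (F0 _ h10).
have E2 := IH _ _ us' (IF _ Ih2) (F0 _ h20).
have -> : (fun w => \prod_(i <- k :: s1 ++ s2) f i (X i w)) =
    (fun w => \prod_(i <- s1 ++ k :: s2) F h1 i (X i w) -
              \prod_(i <- s1 ++ k :: s2) F h2 i (X i w)).
  apply/funext => w; rewrite (FE h1 (fun h i => h (X i w))) (FE h2 (fun h i => h (X i w))).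
  by rewrite big_cons -mulrBl /h1 /h2 opprB addrC subrK.
rewrite RintegralB//; [|exact: integrable_indep_prod (IF _ Ih1)|exact: integrable_indep_prod (IF _ Ih2)].
rewrite E1 E2 (FE h1 (fun h i => \int[nu]_x h x)) (FE h2 (fun h i => \int[nu]_x h x)).
rewrite -mulrBl big_cons -RintegralB//; congr (_ * _); apply: eq_Rintegral => x _.
by rewrite /h1 /h2 opprB addrC subrK.
Qed.

End independent_products.

(** * Moments of the standard normal law *)

Section gaussian_moments.
Context {R : realType}.
Local Notation phi := (@normal_pdf R 0 1).
Local Notation leb := (@lebesgue_measure R).
Local Notation N01 := (normal_prob (0 : R) 1 : probability (measurableTypeR R) R).

Lemma std_normal_pdfE x : phi x = normal_peak 1 * expR (- (x ^+ 2 / 2)).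
Proof.
by rewrite normal_pdfE ?oner_eq0// /normal_fun subr0 expr1n mulNr.
Qed.

Lemma sqrt2_neq0 : Num.sqrt 2 != 0 :> R.
Proof. by rewrite gt_eqF// sqrtr_gt0. Qed.

Lemma sqrt2_normal_pdfE (x : R) :
  normal_pdf 0 (Num.sqrt 2) x = normal_peak (Num.sqrt 2) * expR (- (x ^+ 2 / 4)).
Proof.
rewrite normal_pdfE ?sqrt2_neq0// /normal_fun subr0 sqr_sqrtr// mulNr.
by have -> : 2 *+ 2 = 4 :> R by ring.
Qed.

(** This is the [k]-th power of [|x| <= 4k + x^2 = 4k (1 + x^2 / (4k)) <= 4k exp (x^2 / (4k))]. *)
Lemma expr_le_expR k (x : R) : `|x| ^+ k <= (4 * k%:R) ^+ k * expR (x ^+ 2 / 4).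
Proof.
case: k => [|k]; first by rewrite !expr0 mul1r -expR0 ler_expR divr_ge0 ?sqr_ge0.
have k0 : 0 < k.+1%:R :> R by rewrite ltr0n.
have k1 : 1 <= k.+1%:R :> R by rewrite ler1n.
have -> : x ^+ 2 / 4 = k.+1%:R * (x ^+ 2 / 4 / k.+1%:R) by field; rewrite gt_eqF.
rewrite expRM_natl -exprMn; apply: lerXn2r; rewrite ?nnegrE ?normr_ge0 ?mulr_ge0 ?expR_ge0//.
have := expR_ge1Dx (x ^+ 2 / 4 / k.+1%:R).
move: (expR _) => E hE; apply: (@le_trans _ _ (4 * k.+1%:R * (1 + x ^+ 2 / 4 / k.+1%:R))).
  have -> : 4 * k.+1%:R * (1 + x ^+ 2 / 4 / k.+1%:R) = 4 * k.+1%:R + x ^+ 2.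
    by field; rewrite gt_eqF.
  by rewrite -real_normK ?num_real//; nra.
by apply: ler_wpM2l => //; nra.
Qed.

(** Half of the exponent [x^2 / 2] absorbs the power; the other half is, up to a constant, the
    normal density of variance 2. That density is integrable and bounded, which yields both the
    moments and the decay at infinity. *)
Lemma expr_normal_pdf_le k : exists C : R, 0 <= C /\
  forall x, `|x| ^+ k * phi x <= C * normal_pdf 0 (Num.sqrt 2) x.
Proof.
have p0 : 0 < normal_peak (Num.sqrt 2) :> R by apply: normal_peak_gt0; exact: sqrt2_neq0.
have q0 : 0 < normal_peak 1 :> R by apply: normal_peak_gt0; rewrite oner_eq0.
exists ((4 * k%:R) ^+ k * normal_peak 1 / normal_peak (Num.sqrt 2)); split.
  by rewrite divr_ge0 ?mulr_ge0 ?exprn_ge0 ?mulr_ge0 ?(ltW q0) ?(ltW p0).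
move=> x; rewrite std_normal_pdfE sqrt2_normal_pdfE.
rewrite [leRHS]mulrA divfK ?gt_eqF//.
have -> : - (x ^+ 2 / 2) = - (x ^+ 2 / 4) + - (x ^+ 2 / 4) :> R by field.
have : `|x| ^+ k * expR (- (x ^+ 2 / 4)) <= (4 * k%:R) ^+ k.
  by rewrite expRN ler_pdivrMr ?expR_gt0// expr_le_expR.
have E0 := expR_ge0 (- (x ^+ 2 / 4)).
rewrite expRD; move: (expR _) E0 => E E0 h.
have -> : `|x| ^+ k * (normal_peak 1 * (E * E)) = (`|x| ^+ k * E) * (normal_peak 1 * E) by ring.
by rewrite -[leRHS]mulrA ler_wpM2r ?mulr_ge0 ?(ltW q0).
Qed.

Lemma integrable_expr_normal_pdf k :
  leb.-integrable setT (fun x => (x ^+ k * phi x)%:E).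
Proof.
have [C [C0 hC]] := expr_normal_pdf_le k.
have := integrableZl measurableT C (integrable_normal_pdf (0 : R) (Num.sqrt 2)).
apply: le_integrable => //.
  apply/measurable_EFinP; apply: measurable_funM; first exact: measurable_funX.
  exact: measurable_normal_pdf.
move=> x _ /=; rewrite lee_fin normrM normrX (ger0_norm (normal_pdf_ge0 _ _ _)).
by rewrite [leRHS]ger0_norm ?mulr_ge0 ?normal_pdf_ge0.
Qed.

Lemma integral_std_normal (f : R -> \bar R) : (forall y, (0 <= f y)%E) ->
  measurable_fun setT f ->
  (\int[N01]_x f x = \int[leb]_x (f x * (phi x)%:E))%E.
Proof.
move=> f0 mf.
have := @ge0_integral_density _ _ (measurableTypeR R) (measurableTypeR R) R leb N01 id phi.
move=> H; apply/esym; apply: H => //.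
- exact: measurable_normal_pdf.
- by move=> x; exact: normal_pdf_ge0.
Qed.

Lemma integrable_std_normal_expr k : N01.-integrable setT (EFin \o (fun x => x ^+ k)).
Proof.
apply/integrableP; split; first by apply/measurable_EFinP; exact: measurable_funX.
rewrite integral_std_normal//=; last first.
  by apply/measurable_EFinP/measurableT_comp => //; exact: measurable_funX.
have /integrableP[_] := integrable_expr_normal_pdf k; apply: le_lt_trans.
rewrite le_eqVlt; apply/orP; left; apply/eqP; apply: eq_integral => x _ /=.
by rewrite -EFinM normrM (ger0_norm (normal_pdf_ge0 _ _ _)).
Qed.

Lemma Rintegral_std_normal_ge0 (h : R -> R) : (forall x, 0 <= h x) ->
  measurable_fun setT h -> \int[N01]_x h x = \int[leb]_x (h x * phi x).
Proof.
move=> h0 mh; rewrite /Rintegral integral_std_normal//.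
exact/measurable_EFinP.
Qed.

Lemma Rintegral_std_normal_expr k : \int[N01]_x x ^+ k = \int[leb]_x (x ^+ k * phi x).
Proof.
(* Odd powers change sign, so the nonnegative transfer is applied to [|x^k|] and [|x^k| - x^k]. *)
pose h1 (x : R) := `|x ^+ k|; pose h2 (x : R) := `|x ^+ k| - x ^+ k.
have mX : measurable_fun setT (fun x : R => x ^+ k) by exact: measurable_funX.
have m1 : measurable_fun setT h1 by exact: measurableT_comp.
have m2 : measurable_fun setT h2 by exact: measurable_funB.
have I1 : N01.-integrable setT (EFin \o h1).
  by have /= := integrable_abse (integrable_std_normal_expr k).
have I2 : N01.-integrable setT (EFin \o h2).
  by have /= := integrableB measurableT I1 (integrable_std_normal_expr k).
have J1 : leb.-integrable setT (EFin \o (fun x => h1 x * phi x)).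
  have := integrable_abse (integrable_expr_normal_pdf k).
  apply: eq_integrable => // x _ /=.
  by rewrite normrM (ger0_norm (normal_pdf_ge0 _ _ _)).
have J2 : leb.-integrable setT (EFin \o (fun x => h2 x * phi x)).
  have := integrableB measurableT J1 (integrable_expr_normal_pdf k).
  by apply: eq_integrable => // x _ /=; rewrite /h2 mulrBl.
transitivity (\int[N01]_x (h1 x - h2 x)).
  by apply: eq_Rintegral => x _; rewrite /h1 /h2 opprB addrC subrK.
rewrite RintegralB// !Rintegral_std_normal_ge0//; last 2 first.
  by move=> x; rewrite subr_ge0 ler_norm.
  by move=> x; exact: normr_ge0.
rewrite -RintegralB//; apply: eq_Rintegral => x _.
by rewrite /h1 /h2 -mulrBl opprB addrC subrK.
Qed.

Lemma is_derive_std_normal_pdf (x : R) : is_derive x 1 phi (- x * phi x).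
Proof.
have -> : phi = (fun y => normal_peak 1 * expR (- (y ^+ 2 / 2))).
  by apply/funext => y; rewrite std_normal_pdfE.
have D2 : is_derive x 1 (fun y : R => - (y ^+ 2 / 2)) (- x).
  have D1 : is_derive x 1 ((id : R -> R) ^+ 2) ((2%:R * x ^+ 1) *: 1) by exact: is_deriveX.
  have -> : (fun y : R => - (y ^+ 2 / 2)) = - (2^-1 \*: ((id : R -> R) ^+ 2)).
    by apply/funext => y; rewrite !fctE /GRing.scale /= mulrC.
  have := is_deriveN (is_deriveZ 2^-1 D1) => h; apply: (is_derive_eq h).
  by rewrite /GRing.scale /=; field.
have D3 := is_derive1_comp (is_derive_expR _) D2.
have := is_deriveZ (normal_peak 1) D3 => h; apply: (is_derive_eq h).
by rewrite /GRing.scale /=; ring.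
Qed.

Lemma is_derive_expr_normal_pdf k (x : R) :
  is_derive x 1 (fun y => y ^+ k * phi y)
    (k%:R * (x ^+ k.-1 * phi x) - x ^+ k.+1 * phi x).
Proof.
have D1 : is_derive x 1 ((id : R -> R) ^+ k) ((k%:R * x ^+ k.-1) *: 1) by exact: is_deriveX.
have -> : (fun y => y ^+ k * phi y) = ((id : R -> R) ^+ k) * phi.
  by apply/funext => y; rewrite !fctE.
have := is_deriveM D1 (is_derive_std_normal_pdf x) => h; apply: (is_derive_eq h).
by rewrite /GRing.scale /= !fctE exprS; ring.
Qed.

Lemma continuous_expr_normal_pdf k : continuous (fun y : R => y ^+ k * phi y).
Proof.
move=> x; apply: differentiable_continuous; apply/derivable1_diffP.
by have [] := is_derive_expr_normal_pdf k x.
Qed.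

(** Domination of the power [k + 1], divided by [|x|]: the decay that removes the boundary terms of
    the integration by parts. *)
Lemma expr_normal_pdf_bound k : exists C : R, forall x, 0 < x ->
  `|x ^+ k * phi x| <= C / x /\ `|(- x) ^+ k * phi (- x)| <= C / x.
Proof.
have [C [C0 hC]] := expr_normal_pdf_le k.+1.
have H (y : R) : y != 0 -> `|y ^+ k * phi y| <= C * normal_peak (Num.sqrt 2) / `|y|.
  move=> y0; rewrite ler_pdivlMr ?normr_gt0// normrM (ger0_norm (normal_pdf_ge0 _ _ _)).
  rewrite normrX mulrAC -exprSr (le_trans (hC y))// ler_wpM2l//.
  exact/normal_pdf_ub/sqrt2_neq0.
exists (C * normal_peak (Num.sqrt 2)) => x x0; have xE : `|x| = x by rewrite gtr0_norm.
split; first by have := H x; rewrite xE; apply; rewrite gt_eqF.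
by have := H (- x); rewrite normrN xE; apply; rewrite oppr_eq0 gt_eqF.
Qed.

(** Gaussian integration by parts: the derivative of [x^k phi] is [k x^(k-1) phi - x^(k+1) phi] and
    integrates to 0 over the line. For [k = 0] the factor 0 neutralizes the truncated predecessor,
    and the mean vanishes. *)
Lemma std_normal_moment_rec k :
  \int[N01]_x x ^+ k.+1 = k%:R * \int[N01]_x x ^+ k.-1.
Proof.
rewrite !Rintegral_std_normal_expr.
pose F (y : R) := y ^+ k * phi y.
pose G (x : R) := k%:R * (x ^+ k.-1 * phi x) - x ^+ k.+1 * phi x.
have I1 := integrable_expr_normal_pdf k.-1; have I2 := integrable_expr_normal_pdf k.+1.
have IZ : leb.-integrable setT (EFin \o (fun x => k%:R * (x ^+ k.-1 * phi x))).
  by have /= := integrableZl measurableT k%:R I1.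
have IG : leb.-integrable setT (EFin \o G) by have /= := integrableB measurableT IZ I2.
suff GE : \int[leb]_x G x = 0.
  by apply/esym/eqP; rewrite -subr_eq0 -RintegralZl// -RintegralB// GE.
have cG : continuous G.
  move=> x; apply: cvgB; last exact: continuous_expr_normal_pdf.
  by apply: cvgM; [exact: cvg_cst|exact: continuous_expr_normal_pdf].
(* The integral over the line is the limit over these intervals by dominated convergence; starting
   at [n + 1] keeps them nondegenerate and [C / x] meaningful. *)
pose D n : set R := `[- n.+1%:R, n.+1%:R]%classic.
have FTC n : (\int[leb]_(x in D n) (G x)%:E = (F n.+1%:R - F (- n.+1%:R))%:E)%E.
  rewrite EFinB; apply: continuous_FTC2.
  - by rewrite gtrN// ltr0n.
  - by apply: continuous_subspaceT.
  - split.
    + by move=> x _; have [] := is_derive_expr_normal_pdf k x.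
    + by apply: cvg_at_right_filter; exact: continuous_expr_normal_pdf.
    + by apply: cvg_at_left_filter; exact: continuous_expr_normal_pdf.
  - by move=> x _; rewrite derive1E; have [_ ->] := is_derive_expr_normal_pdf k x.
have c1 : (fun n => \int[leb]_(x in D n) (G x)%:E)%E @ \oo --> (\int[leb]_x (G x)%:E)%E.
  have mG : measurable_fun setT (EFin \o G) by case/integrableP : IG.
  have [] := @dominated_convergence _ _ _ leb setT measurableT
    (fun n => (EFin \o G) \_ (D n)) (EFin \o G) (abse \o (EFin \o G)).
  - move=> n; apply: (measurable_restrictT (EFin \o G) _).1;
      [exact: measurable_itv|exact: measurable_funTS].
  - exact: mG.
  - apply: aeW => x _; apply: cvg_near_cst.
    near=> n; rewrite patchE mem_set//= /D /= in_itv /= -ler_norml.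
    by rewrite (le_trans (ltW (truncnS_gt `|x|)))// ler_nat ltnS; near: n; exact: nbhs_infty_ge.
  - exact: integrable_abse.
  - apply: aeW => x n _ /=; rewrite patchE; case: ifPn => // _.
    by rewrite abse0.
  move=> _ _; apply: cvg_trans; apply: near_eq_cvg; near=> n.
  by rewrite [RHS]integral_mkcond.
have c2 : (fun n => F n.+1%:R - F (- n.+1%:R)) @ \oo --> (0 : R).
  have [C hC] := expr_normal_pdf_bound k.
  apply: (@squeeze_cvgr _ _ _ _ (fun n => - (2 * C) * n.+1%:R^-1) (fun n => (2 * C) * n.+1%:R^-1)).
  - near=> n; have n0 : 0 < n.+1%:R :> R by rewrite ltr0n.
    have [] := hC _ n0.
    rewrite -[_ ^+ k * _]/(F n.+1%:R) -[(- _) ^+ k * _]/(F (- n.+1%:R)).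
    move: (F _) (F (- _)) => a b; rewrite !ler_norml => /andP[h1 h2] /andP[h3 h4].
    by rewrite mulNr -!mulrA; move: (C / _) h1 h2 h3 h4 => c *; apply/andP; split; lra.
  - rewrite -(mulr0 (- (2 * C))); apply: cvgM; [exact: cvg_cst|exact: cvg_harmonic].
  - rewrite -(mulr0 (2 * C)); apply: cvgM; [exact: cvg_cst|exact: cvg_harmonic].
rewrite (funext FTC) in c1.
rewrite /Rintegral; have -> : (\int[leb]_x (G x)%:E = 0)%E; last by [].
apply: cvg_unique c1 _; first exact: ereal_hausdorff.
apply: cvg_EFin; last exact: c2.
by near=> n.
Unshelve. all: by end_near. Qed.

Lemma std_normal_moment0 : \int[N01]_x x ^+ 0 = 1.
Proof.
under eq_Rintegral do rewrite expr0.
rewrite Rintegral_cst// mul1r.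
by have /= -> := @probability_setT _ _ _ N01.
Qed.

End gaussian_moments.

(** * Polynomials in independent Gaussians *)

Lemma sum_delta (R : pzRingType) n (f : 'I_n -> R) (k : 'I_n) :
  \sum_l f l * (k == l)%:R = f k.
Proof.
rewrite (bigD1 k)//= eqxx mulr1 big1 ?addr0// => l lk.
by rewrite eq_sym (negbTE lk) mulr0.
Qed.

Section gaussian_polynomials.
Context {R : realType} dT {T : measurableType dT} (P : probability T R).
Context {I : eqType} (X : I -> T -> R).
Hypothesis indX : mutually_independent P X.
Hypothesis normX : forall i, std_normal P (X i).

Local Notation N01 := (normal_prob (0 : R) 1 : probability (measurableTypeR R) R).
Local Notation Esp f := (\int[P]_w f w).
Local Notation M k := (\int[N01]_x x ^+ k).

Definition monom (K : seq I) (a : I -> nat) (w : T) : R :=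
  \prod_(k <- K) X k w ^+ a k.

Definition gmoment (K : seq I) (a : I -> nat) : R := \prod_(k <- K) M (a k).

Lemma integrable_monom K a : uniq K -> P.-integrable setT (EFin \o monom K a).
Proof.
move=> uK; apply: (@integrable_indep_prod _ _ _ P _ X N01 _ _ _ K (fun k x => x ^+ a k)) => //.
- by move=> i; case: (normX i).
- by move=> i; case: (normX i).
- by move=> i; exact: integrable_std_normal_expr.
Qed.

Lemma Rintegral_monom K a : uniq K -> Esp (monom K a) = gmoment K a.
Proof.
move=> uK; apply: (@Rintegral_indep_prod _ _ _ P _ X N01 _ _ _ K (fun k x => x ^+ a k)) => //.
- by move=> i; case: (normX i).
- by move=> i; case: (normX i).
- by move=> i; exact: integrable_std_normal_expr.
Qed.

(** Wick's rule for one extra factor [X i]: it is paired with each of the [a i] copies present. When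
    [a i = 0] the coefficient vanishes and the truncated subtraction is harmless. *)
Lemma gmomentS K a i : uniq K -> i \in K ->
  gmoment K (fun m => ((m == i) + a m)%N) =
  (a i)%:R * gmoment K (fun m => (a m - (m == i))%N).
Proof.
move=> uK iK; rewrite /gmoment !(bigD1_seq i)//= eqxx std_normal_moment_rec subn1 mulrA.
by congr (_ * _); apply: eq_bigr => m /negbTE ->; rewrite subn0.
Qed.

Lemma eq_gmoment K a b : a =1 b -> gmoment K a = gmoment K b.
Proof. by move=> ab; apply: eq_bigr => k _; rewrite ab. Qed.

Lemma gmoment0 K : gmoment K (fun=> 0%N) = 1.
Proof. by rewrite /gmoment big1// => k _; rewrite std_normal_moment0. Qed.

Lemma gmoment2 K i j : uniq K -> i \in K ->
  gmoment K (fun m => ((m == i) + (m == j))%N) = (i == j)%:R.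
Proof.
move=> uK iK; rewrite gmomentS//; case: eqVneq => [<-|_]; rewrite ?mul0r// mul1r.
by rewrite -[RHS](gmoment0 K); apply: eq_gmoment => m; rewrite subnn.
Qed.

(** Here the multiplicity of [i] among the other three is [(i == j) + (i == k) + (i == l)]; its
    three summands are the three pairings. *)
Lemma gmoment4 K i j k l : uniq K -> i \in K -> j \in K -> k \in K ->
  gmoment K (fun m => ((m == i) + ((m == j) + ((m == k) + (m == l))))%N) =
  (i == j)%:R * (k == l)%:R + (i == k)%:R * (j == l)%:R + (i == l)%:R * (j == k)%:R.
Proof.
move=> uK iK jK kK; rewrite gmomentS// !natrD !mulrDl addrA; congr (_ + _ + _).
- case: eqVneq => [<-|_]; rewrite ?mul0r// !mul1r -(gmoment2 l uK kK).
  by apply: eq_gmoment => m; rewrite addKn.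
- case: eqVneq => [<-|_]; rewrite ?mul0r// !mul1r -(gmoment2 l uK jK).
  by apply: eq_gmoment => m; rewrite addnCA addKn.
- case: eqVneq => [<-|_]; rewrite ?mul0r// !mul1r -(gmoment2 k uK jK).
  by apply: eq_gmoment => m; rewrite addnA addnK.
Qed.

(** The list [K] records which coordinates a function may depend on, and so plays the part of
    measurability with respect to the past. *)
Definition polyspan (K : seq I) (f : T -> R) :=
  exists L : seq (R * (I -> nat)), f = fun w => \sum_(l <- L) l.1 * monom K l.2 w.

Lemma polyspanZ_monom K c a : polyspan K (fun w => c * monom K a w).
Proof. by exists [:: (c, a)]; apply/funext => w; rewrite big_seq1. Qed.

Lemma polyspan_ind K (Q : (T -> R) -> Prop) :
  Q (fun=> 0) -> (forall c a f, polyspan K f -> Q f -> Q (fun w => c * monom K a w + f w)) ->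
  forall f, polyspan K f -> Q f.
Proof.
move=> Q0 QS f [L ->]; elim: L => [|[c a] L IH].
  by under eq_fun do rewrite big_nil.
by under eq_fun do rewrite big_cons; apply: QS => //; exists L.
Qed.

Lemma polyspan0 K : polyspan K (fun=> 0).
Proof. by exists [::]; apply/funext => w; rewrite big_nil. Qed.

Lemma polyspanD K f g : polyspan K f -> polyspan K g -> polyspan K (fun w => f w + g w).
Proof.
by move=> [L ->] [L' ->]; exists (L ++ L'); apply/funext => w; rewrite big_cat.
Qed.

Lemma polyspanM K f g : polyspan K f -> polyspan K g -> polyspan K (fun w => f w * g w).
Proof.
move=> Pf Pg; move: f Pf; apply: polyspan_ind.
  by under eq_fun do rewrite mul0r; exact: polyspan0.
move=> c a f _ Pfg; under eq_fun do rewrite mulrDl; apply: polyspanD => //.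
move: g Pg {Pfg f}; apply: polyspan_ind.
  by under eq_fun do rewrite mulr0; exact: polyspan0.
move=> d b g _ Pg; under eq_fun do rewrite mulrDr; apply: polyspanD => //.
exists [:: (c * d, fun k => (a k + b k)%N)]; apply/funext => w; rewrite big_seq1 /=.
rewrite mulrACA; congr (_ * _); rewrite /monom -big_split /=.
by apply: eq_bigr => k _; rewrite exprD.
Qed.

Lemma polyspan_cst K c : polyspan K (fun=> c).
Proof.
exists [:: (c, fun=> 0%N)]; apply/funext => w; rewrite big_seq1 /monom big1 ?mulr1//.
Qed.

Lemma polyspanZ K c f : polyspan K f -> polyspan K (fun w => c * f w).
Proof. by move=> Pf; apply: polyspanM => //; exact: polyspan_cst. Qed.

Lemma polyspanB K f g : polyspan K f -> polyspan K g -> polyspan K (fun w => f w - g w).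
Proof.
move=> Pf Pg; under eq_fun do rewrite -mulN1r; apply: polyspanD => //.
exact: polyspanZ.
Qed.

Lemma polyspanX K f k : polyspan K f -> polyspan K (fun w => f w ^+ k).
Proof.
move=> Pf; elim: k => [|k IH]; first exact: polyspan_cst.
by under eq_fun do rewrite exprS; exact: polyspanM.
Qed.

Lemma polyspan_sum K n (f : 'I_n -> T -> R) : (forall i, polyspan K (f i)) ->
  polyspan K (fun w => \sum_i f i w).
Proof.
elim: n f => [|n IH] f Pf; first by under eq_fun do rewrite big_ord0; exact: polyspan0.
by under eq_fun do rewrite big_ord_recl; apply: polyspanD => //; exact: IH.
Qed.

Lemma polyspan_var K k : uniq K -> k \in K -> polyspan K (X k).
Proof.
move=> uK kK; exists [:: (1, fun j => (j == k) : nat)]; apply/funext => w.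
rewrite big_seq1 mul1r /monom (bigD1_seq k)//= eqxx expr1 big1 ?mulr1// => j.
by move=> /negbTE ->.
Qed.

Lemma monom_cat K K' a b w : uniq (K ++ K') ->
  monom (K ++ K') (fun k => if k \in K then a k else b k) w = monom K a w * monom K' b w.
Proof.
rewrite cat_uniq => /and3P[_ /hasPn KK' _]; rewrite /monom big_cat /=; congr (_ * _).
  by apply: eq_big_seq => k ->.
by apply: eq_big_seq => k /KK' /negbTE ->.
Qed.

Lemma polyspan_catl K K' f : uniq (K ++ K') -> polyspan K f -> polyspan (K ++ K') f.
Proof.
move=> uK; move: f; apply: polyspan_ind; first exact: polyspan0.
move=> c a f _ Pf; apply: polyspanD => //.
exists [:: (c, fun k => if k \in K then a k else 0%N)]; apply/funext => w.
by rewrite big_seq1 /= monom_cat// [monom K' _ _]big1 ?mulr1.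
Qed.

Lemma polyspan_integrable K f : uniq K -> polyspan K f -> P.-integrable setT (EFin \o f).
Proof.
move=> uK; move: f; apply: polyspan_ind; first exact: integrable0.
move=> c a f _ If.
by have /= := integrableD measurableT (integrableZl measurableT c (integrable_monom a uK)) If.
Qed.

Lemma RintegralD_poly K f g : uniq K -> polyspan K f -> polyspan K g ->
  Esp (fun w => f w + g w) = Esp f + Esp g.
Proof. by move=> uK Pf Pg; rewrite RintegralD//; exact: polyspan_integrable uK _. Qed.

Lemma RintegralB_poly K f g : uniq K -> polyspan K f -> polyspan K g ->
  Esp (fun w => f w - g w) = Esp f - Esp g.
Proof. by move=> uK Pf Pg; rewrite RintegralB//; exact: polyspan_integrable uK _. Qed.

Lemma RintegralZ_poly K c f : uniq K -> polyspan K f ->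
  Esp (fun w => c * f w) = c * Esp f.
Proof. by move=> uK Pf; rewrite RintegralZl//; exact: polyspan_integrable uK _. Qed.

Lemma Rintegral_sum_poly K n (f : 'I_n -> T -> R) : uniq K ->
  (forall i, polyspan K (f i)) ->
  Esp (fun w => \sum_i f i w) = \sum_i Esp (f i).
Proof.
move=> uK; elim: n f => [|n IH] f Pf.
  under eq_Rintegral do rewrite big_ord0.
  by rewrite big_ord0 Rintegral_cst// mul0r.
under eq_Rintegral do rewrite big_ord_recl.
rewrite (RintegralD_poly uK)//; last exact: polyspan_sum.
by rewrite big_ord_recl IH.
Qed.

(** Independence of past and present: by linearity [f] is a monomial over [K], and its product with
    one over [K'] is a single monomial over [K ++ K'], whose moment factors. *)
Lemma Rintegral_poly_monom K K' f b : uniq (K ++ K') -> polyspan K f ->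
  Esp (fun w => f w * monom K' b w) = Esp f * gmoment K' b.
Proof.
move=> uKK; have uK : uniq K by move: uKK; rewrite cat_uniq => /andP[].
move: f; apply: polyspan_ind.
  under eq_Rintegral do rewrite mul0r.
  by rewrite !Rintegral_cst// !mul0r.
move=> c a f Pf IH; under eq_Rintegral do rewrite mulrDl -mulrA -monom_cat//.
rewrite (RintegralD_poly uKK); last 2 first.
- exact: polyspanZ_monom.
- apply: polyspanM; first exact: polyspan_catl.
  exists [:: (1, fun k => if k \in K then 0%N else b k)]; apply/funext => w.
  by rewrite big_seq1 /= monom_cat// [monom K _ _]big1 ?mul1r.
rewrite (RintegralD_poly uK)//; last exact: polyspanZ_monom.
rewrite IH mulrDl; congr (_ + _).
rewrite RintegralZl//; last exact: integrable_monom.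
rewrite RintegralZl//; last exact: integrable_monom.
rewrite !Rintegral_monom// -mulrA; congr (_ * _).
rewrite /gmoment big_cat /=; move: uKK; rewrite cat_uniq => /and3P[_ /hasPn KK' _].
congr (_ * _); first by apply: eq_big_seq => k ->.
by apply: eq_big_seq => k /KK' /negbTE ->.
Qed.

(** * Quadratic forms in a fresh Gaussian vector *)

Section fresh_variables.
Variables (K : seq I) (n : nat) (u : 'I_n -> I).
Hypothesis uinj : injective u.
Hypothesis uK : uniq (K ++ [seq u i | i <- enum 'I_n]).
Local Notation K' := [seq u i | i <- enum 'I_n].

Let uK' : uniq K'. Proof. by move: uK; rewrite cat_uniq => /and3P[]. Qed.
Let uKl : uniq K. Proof. by move: uK; rewrite cat_uniq => /and3P[]. Qed.
Let memu i : u i \in K'. Proof. by rewrite map_f// mem_enum. Qed.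

Let monom2 i j w : monom K' (fun m => ((m == u i) + (m == u j))%N) w = X (u i) w * X (u j) w.
Proof.
have one k : X (u k) w = monom K' (fun m => (m == u k) : nat) w.
  rewrite /monom (bigD1_seq (u k))//= eqxx expr1 big1 ?mulr1// => j'.
  by move=> /negbTE ->.
by rewrite !one /monom -big_split /=; apply: eq_bigr => m _; rewrite exprD.
Qed.

Let monom4 i j k l w : monom K'
    (fun m => ((m == u i) + ((m == u j) + ((m == u k) + (m == u l))))%N) w =
  X (u i) w * X (u j) w * (X (u k) w * X (u l) w).
Proof.
rewrite -!monom2 /monom -big_split /=; apply: eq_bigr => m _.
by rewrite addnA exprD.
Qed.

Lemma polyspan_fresh i : polyspan (K ++ K') (X (u i)).
Proof. by apply: polyspan_var => //; rewrite mem_cat memu orbT. Qed.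

Lemma Rintegral_fresh2 f i j : polyspan K f ->
  Esp (fun w => f w * (X (u i) w * X (u j) w)) = Esp f * (i == j)%:R.
Proof.
move=> Pf; under eq_Rintegral do rewrite -monom2.
by rewrite (Rintegral_poly_monom _ uK)// gmoment2// inj_eq.
Qed.

Lemma Rintegral_fresh4 f i j k l : polyspan K f ->
  Esp (fun w => f w * (X (u i) w * X (u j) w * (X (u k) w * X (u l) w))) =
  Esp f * ((i == j)%:R * (k == l)%:R + (i == k)%:R * (j == l)%:R + (i == l)%:R * (j == k)%:R).
Proof.
move=> Pf; under eq_Rintegral do rewrite -monom4.
by rewrite (Rintegral_poly_monom _ uK)// gmoment4// !inj_eq.
Qed.

Variables (a : 'I_n -> T -> R) (v : 'I_n -> R).
Hypothesis Pa : forall i, polyspan K (a i).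
Let A w := \sum_i a i w * X (u i) w.
Let V w := \sum_i v i * X (u i) w.
Let av w := \sum_i a i w * v i.

Lemma polyspan_fresh_form : polyspan (K ++ K') A /\ polyspan (K ++ K') V.
Proof.
split; apply: polyspan_sum => i; first apply: polyspanM.
- by apply: polyspan_catl.
- exact: polyspan_fresh.
- by apply: polyspanZ; exact: polyspan_fresh.
Qed.

(** Here [A] and [V] are the scalar products of the fresh vector with the past vector [a] and the
    fixed [v]; its covariance being the identity, only the diagonal terms survive. *)
Lemma Rintegral_form2 f : polyspan K f ->
  Esp (fun w => f w * (A w * V w)) = Esp (fun w => f w * av w).
Proof.
move=> Pf.
have PfX i j : polyspan (K ++ K') (fun w => v j * (f w * a i w * (X (u i) w * X (u j) w))).
  apply: polyspanZ; apply: polyspanM; first by apply: polyspan_catl => //; exact: polyspanM.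
  by apply: polyspanM; exact: polyspan_fresh.
transitivity (Esp (fun w => \sum_i \sum_j v j * (f w * a i w * (X (u i) w * X (u j) w)))).
  apply: eq_Rintegral => w _; rewrite /A /V mulr_suml mulr_sumr; apply: eq_bigr => i _.
  by rewrite !mulr_sumr; apply: eq_bigr => j _; ring.
rewrite (Rintegral_sum_poly uK); last by move=> i; apply: polyspan_sum.
transitivity (Esp (fun w => \sum_i v i * (f w * a i w))); last first.
  apply: eq_Rintegral => w _; rewrite /av mulr_sumr; apply: eq_bigr => i _; ring.
rewrite (Rintegral_sum_poly uKl); last by move=> i; apply/polyspanZ/polyspanM.
apply: eq_bigr => i _; rewrite (Rintegral_sum_poly uK)//.
have Pfa : polyspan K (fun w => f w * a i w) by exact: polyspanM.
rewrite (RintegralZ_poly _ uKl)// -[RHS](sum_delta (fun j => v j * Esp (fun w => f w * a i w)) i).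
apply: eq_bigr => j _; rewrite (RintegralZ_poly _ uK); last first.
  apply: polyspanM; first by apply: polyspan_catl.
  by apply: polyspanM; exact: polyspan_fresh.
by rewrite Rintegral_fresh2// mulrA.
Qed.

(** Of the three pairings, the one within each square gives [|v|^2 |a|^2], and each of the two
    crossed ones gives [<a, v>^2]. *)
Lemma Rintegral_form4 :
  Esp (fun w => A w ^+ 2 * V w ^+ 2) =
  (\sum_i v i ^+ 2) * Esp (fun w => \sum_i a i w ^+ 2) + 2 * Esp (fun w => av w ^+ 2).
Proof.
have PX i j k l : polyspan (K ++ K') (fun w => a i w * a j w *
    (X (u i) w * X (u j) w * (X (u k) w * X (u l) w))).
  apply: polyspanM; first by apply: polyspan_catl => //; exact: polyspanM.
  by do 2?apply: polyspanM; exact: polyspan_fresh.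
pose B i j := Esp (fun w => a i w * a j w).
have -> : Esp (fun w => A w ^+ 2 * V w ^+ 2) =
    \sum_i \sum_j \sum_k \sum_l v k * v l *
    (B i j * ((i == j)%:R * (k == l)%:R + (i == k)%:R * (j == l)%:R + (i == l)%:R * (j == k)%:R)).
  transitivity (Esp (fun w => \sum_i \sum_j \sum_k \sum_l v k * v l * (a i w * a j w *
      (X (u i) w * X (u j) w * (X (u k) w * X (u l) w))))).
    apply: eq_Rintegral => w _; rewrite /A /V !expr2 mulr_suml mulr_suml; apply: eq_bigr => i _.
    rewrite mulr_sumr mulr_suml; apply: eq_bigr => j _.
    rewrite mulr_suml mulr_sumr; apply: eq_bigr => k _.
    by rewrite !mulr_sumr; apply: eq_bigr => l _; ring.
  rewrite (Rintegral_sum_poly uK); last first.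
    by move=> i; do 3!(apply: polyspan_sum => ?); apply: polyspanZ.
  apply: eq_bigr => i _; rewrite (Rintegral_sum_poly uK); last first.
    by move=> j; do 2!(apply: polyspan_sum => ?); apply: polyspanZ.
  apply: eq_bigr => j _; rewrite (Rintegral_sum_poly uK); last first.
    by move=> k; apply: polyspan_sum => ?; apply: polyspanZ.
  apply: eq_bigr => k _; rewrite (Rintegral_sum_poly uK); last first.
    by move=> l; apply: polyspanZ.
  apply: eq_bigr => l _; rewrite (RintegralZ_poly _ uK)//.
  by rewrite Rintegral_fresh4//; exact: polyspanM.
have -> : Esp (fun w => \sum_i a i w ^+ 2) = \sum_i B i i.
  by rewrite (Rintegral_sum_poly uKl)// => i; exact: polyspanX.
have -> : Esp (fun w => av w ^+ 2) = \sum_i \sum_j v i * v j * B i j.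
  transitivity (Esp (fun w => \sum_i \sum_j v i * v j * (a i w * a j w))).
    apply: eq_Rintegral => w _; rewrite /av expr2 mulr_suml; apply: eq_bigr => i _.
    by rewrite mulr_sumr; apply: eq_bigr => j _; ring.
  rewrite (Rintegral_sum_poly uKl); last first.
    by move=> i; apply: polyspan_sum => j; apply/polyspanZ/polyspanM.
  apply: eq_bigr => i _; rewrite (Rintegral_sum_poly uKl); last first.
    by move=> j; apply/polyspanZ/polyspanM.
  by apply: eq_bigr => j _; rewrite (RintegralZ_poly _ uKl)//; exact: polyspanM.
rewrite mulr_sumr mulr_sumr -big_split /=; apply: eq_bigr => i _.
(* The right side is expanded back into sums against Kronecker deltas, one index at a time, until
   the summands agree. *)
transitivity (\sum_j ((\sum_k v k ^+ 2) * B i j * (i == j)%:R + 2 * (v i * v j * B i j))); last first.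
  by rewrite big_split /= sum_delta -mulr_sumr.
apply: eq_bigr => j _.
transitivity (\sum_k (v k ^+ 2 * B i j * (i == j)%:R
   + (v k * v j * B i j) * (i == k)%:R + (v k * v i * B i j) * (j == k)%:R)); last first.
  rewrite !big_split /= !sum_delta -!mulr_suml; ring.
apply: eq_bigr => k _.
transitivity (\sum_l ((v k * v l * B i j * (i == j)%:R) * (k == l)%:R
   + (v k * v l * B i j * (i == k)%:R) * (j == l)%:R
   + (v k * v l * B i j * (j == k)%:R) * (i == l)%:R)); last first.
  rewrite !big_split /= !sum_delta; ring.
by apply: eq_bigr => l _; ring.
Qed.

End fresh_variables.
End gaussian_polynomials.

(** * Moments of the iterates *)

Fixpoint ms_iter (R : pzRingType) n (lam : 'I_n -> R) (eta : R) (s0 : 'I_n -> R) (t : nat) :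
    'I_n -> R :=
  if t is t'.+1 then
    let s := ms_iter lam eta s0 t' in
    fun j => (1 - 2 * (eta * lam j) + 2 * (eta * lam j) ^+ 2) * s j
             + eta ^+ 2 * \sum_k lam k ^+ 2 * s k
  else s0.

Lemma fquad_central_difference (R : realType) n (H : 'M[R]_n) xstar fstar mu (x u : 'rV[R]_n) :
  H^T = H -> mu != 0 ->
  (fquad H xstar fstar (x + mu *: u) - fquad H xstar fstar (x - mu *: u)) / (2 * mu) =
  ((x - xstar) *m H *m u^T) ord0 ord0.
Proof.
move=> Hs mu0; rewrite /fquad.
have -> : x + mu *: u - xstar = x - xstar + mu *: u by rewrite addrAC.
have -> : x - mu *: u - xstar = x - xstar + (- mu) *: u by rewrite addrAC scaleNr.
move: (x - xstar) => e.
have sym : (u *m H *m e^T) ord0 ord0 = (e *m H *m u^T) ord0 ord0.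
  transitivity ((u *m H *m e^T)^T ord0 ord0); first by rewrite [RHS]mxE.
  by rewrite !trmx_mul trmxK Hs mulmxA.
have ex c : ((e + c *: u) *m H *m (e + c *: u)^T) ord0 ord0 =
    (e *m H *m e^T) ord0 ord0 + 2 * c * (e *m H *m u^T) ord0 ord0
    + c ^+ 2 * (u *m H *m u^T) ord0 ord0.
  rewrite [(_ + _)^T]raddfD /= [(c *: u)^T]linearZ /= !mulmxDl !mulmxDr.
  rewrite -!scalemxAl -!scalemxAr scalerA.
  have D (A B : 'M[R]_1) : (A + B) ord0 ord0 = A ord0 ord0 + B ord0 ord0 by rewrite mxE.
  have Z k (A : 'M[R]_1) : (k *: A) ord0 ord0 = k * A ord0 ord0 by rewrite mxE.
  rewrite !(D, Z) sym; ring.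
rewrite !ex; field; exact: mu0.
Qed.

Section dynamics.
Context {R : realType} {n : nat} dT {T : measurableType dT} (P : probability T R).
Variables (g : nat -> 'I_n -> T -> R) (H Q : 'M[R]_n) (lam : 'I_n -> R).
Variables (xstar : 'rV[R]_n) (fstar mu eta : R).
Hypothesis gG : iid_std_gaussian_vectors P g.
Hypothesis Hs : H^T = H.
Hypothesis QQ : Q *m Q^T = 1%:M.
Hypothesis QH : Q *m H *m Q^T = diag_mx (\row_i lam i).
Hypothesis mu0 : 0 < mu.

Let X (ti : nat * 'I_n) := g ti.1 ti.2.
Local Notation Esp f := (\int[P]_w f w).

(** The coordinates drawn before step [t], arranged so that [past t.+1] is literally [past t]
    followed by the fresh block indexed by [pair t]. *)
Fixpoint past (t : nat) : seq (nat * 'I_n) :=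
  if t is t'.+1 then past t' ++ [seq (t', i) | i <- enum 'I_n] else [::].

Lemma past_lt t k : k \in past t -> (k.1 < t)%N.
Proof.
elim: t => [//|t IH]; rewrite /= mem_cat => /orP[/IH/ltnW//|/mapP[i _ ->]/=].
exact: ltnSn.
Qed.

Lemma past_uniq t : uniq (past t).
Proof.
elim: t => [//|t IH] /=; rewrite cat_uniq IH /= map_inj_uniq ?enum_uniq ?andbT; last first.
  by move=> i j [].
by apply/hasPn => k /mapP[i _ ->]; apply/negP => /past_lt; rewrite ltnn.
Qed.

Let indX : mutually_independent P X. Proof. by case: gG. Qed.
Let normX ti : std_normal P (X ti). Proof. by case: gG => _; exact. Qed.

Variable x0 : 'rV[R]_n.
(** Only the error is rotated, into [y]; the directions keep the coordinates whose independence is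
    assumed, and so does the gradient [a]. The eigenbasis enters through [<a, Q_j> = lam_j y_j] and
    [|Q_j| = 1]. *)
Let e t w := zo_err H xstar fstar eta mu g x0 t w.
Let y t j w := (e t w *m Q^T) ord0 j.
Let a t k w := (e t w *m H) ord0 k.

Let QtQ : Q^T *m Q = 1%:M. Proof. exact: mulmx1C. Qed.

Let eS t w : e t.+1 w = e t w - (eta * (e t w *m H *m (dirs g w t)^T) ord0 ord0) *: dirs g w t.
Proof.
rewrite /e /zo_err /= fquad_central_difference ?gt_eqF//.
by rewrite addrAC.
Qed.

Let eE t w : e t w = (\row_j y t j w) *m Q.
Proof.
have -> : \row_j y t j w = e t w *m Q^T by apply/rowP => j; rewrite mxE.
by rewrite -mulmxA QtQ mulmx1.
Qed.

Let aE t w : e t w *m H = (\row_j y t j w) *m diag_mx (\row_i lam i) *m Q.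
Proof. by rewrite -QH eE !mulmxA -!(mulmxA _ Q^T) QtQ mulmx1. Qed.

Let aaE t k w : a t k w = \sum_j y t j w * lam j * Q j k.
Proof.
rewrite /a aE mul_mx_diag mxE; apply: eq_bigr => j _; by rewrite !mxE.
Qed.

Let yS t j w : y t.+1 j w = y t j w - eta *
  ((\sum_k a t k w * X (t, k) w) * (\sum_k Q j k * X (t, k) w)).
Proof.
rewrite /y eS mulmxBl -scalemxAl mxE [in X in _ + X]mxE [in X in _ + X]mxE mulrA; congr (_ - _ * _ * _).
  by rewrite [LHS]mxE; apply: eq_bigr => k _; congr (_ * _); rewrite !mxE.
by rewrite [LHS]mxE; apply: eq_bigr => k _; rewrite mulrC; congr (_ * _); rewrite !mxE.
Qed.

Let Pa_of t : (forall j, polyspan X (past t) (y t j)) ->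
  forall k, polyspan X (past t) (a t k).
Proof.
move=> Py k; rewrite (_ : a t k = fun w => \sum_j y t j w * lam j * Q j k); last first.
  by apply/funext => w; rewrite aaE.
by apply: polyspan_sum => i; do 2?apply: polyspanM => //; exact: polyspan_cst.
Qed.

(** Step [t] multiplies polynomials over [past t] by the new coordinates [X (t, k)] only, so [y t]
    never involves directions still to come. *)
Let Py t j : polyspan X (past t) (y t j).
Proof.
elim: t j => [|t IH] j.
  have -> : y 0 j = fun=> ((x0 - xstar) *m Q^T) ord0 j by [].
  exact: polyspan_cst.
have -> : y t.+1 j = fun w => y t j w - eta *
  ((\sum_k a t k w * X (t, k) w) * (\sum_k Q j k * X (t, k) w)).
  by apply/funext => w; rewrite yS.
apply: polyspanB; first by apply: polyspan_catl => //; exact: (past_uniq t.+1).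
have [PA PV] := @polyspan_fresh_form _ _ _ _ X (past t) n (pair t) (past_uniq t.+1)
  (a t) (Q j) (Pa_of IH).
by apply: polyspanZ; apply: polyspanM.
Qed.

Let Pa t k : polyspan X (past t) (a t k).
Proof. exact: Pa_of. Qed.

Let avE t j w : \sum_k a t k w * Q j k = lam j * y t j w.
Proof.
transitivity ((e t w *m H *m Q^T) ord0 j).
  by rewrite [RHS]mxE; apply: eq_bigr => k _; congr (_ * _); rewrite mxE.
by rewrite aE -mulmxA QQ mulmx1 mul_mx_diag !mxE mulrC.
Qed.

Let a2E t w : \sum_k a t k w ^+ 2 = \sum_j lam j ^+ 2 * y t j w ^+ 2.
Proof.
transitivity ((e t w *m H *m (e t w *m H)^T) ord0 ord0).
  by rewrite [RHS]mxE; apply: eq_bigr => k _; rewrite [_^T _ _]mxE expr2.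
rewrite aE trmx_mul -mulmxA (mulmxA Q) QQ mul1mx mul_mx_diag mxE; apply: eq_bigr => j _.
by rewrite !mxE; ring.
Qed.

Let Q2 j : \sum_k Q j k ^+ 2 = 1.
Proof.
have /matrixP/(_ j j) := QQ; rewrite !mxE eqxx => h; apply: etrans h.
by apply: eq_bigr => k _; rewrite mxE expr2.
Qed.

Let uinj t : injective (pair t : 'I_n -> nat * 'I_n). Proof. by move=> i j []. Qed.

Let mean_step t j : Esp (y t.+1 j) = (1 - eta * lam j) * Esp (y t j).
Proof.
have [PA PV] := @polyspan_fresh_form _ _ _ _ X (past t) n (pair t) (past_uniq t.+1)
  (a t) (Q j) (Pa t).
have PAV := polyspanM PA PV.
rewrite (_ : y t.+1 j = fun w => y t j w - eta *
  ((\sum_k a t k w * X (t, k) w) * (\sum_k Q j k * X (t, k) w))); last first.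
  by apply/funext => w; rewrite yS.
rewrite (RintegralB_poly indX normX (past_uniq t.+1)); last 2 first.
- by apply: polyspan_catl => //; exact: (past_uniq t.+1).
- exact: polyspanZ.
rewrite (RintegralZ_poly indX normX _ (past_uniq t.+1))//.
have := Rintegral_form2 indX normX (@uinj t) (past_uniq t.+1) (Q j) (Pa t) (polyspan_cst X (past t) 1).
under eq_Rintegral do rewrite mul1r; move=> ->.
under [X in _ - _ * X]eq_Rintegral do rewrite mul1r avE.
rewrite (RintegralZ_poly indX normX _ (past_uniq t))//; ring.
Qed.

(** Squaring [y - eta A V] gives a cross term, worth [lam_j E[y_j^2]], and a quartic term, worth
    [E|a|^2 + 2 lam_j^2 E[y_j^2]]; the norm [|a|^2] is what couples the coordinates. *)
Let ms_step t j : Esp (fun w => y t.+1 j w ^+ 2) =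
  (1 - 2 * (eta * lam j) + 2 * (eta * lam j) ^+ 2) * Esp (fun w => y t j w ^+ 2) +
  eta ^+ 2 * \sum_k lam k ^+ 2 * Esp (fun w => y t k w ^+ 2).
Proof.
have [PA PV] := @polyspan_fresh_form _ _ _ _ X (past t) n (pair t) (past_uniq t.+1)
  (a t) (Q j) (Pa t).
set A := (fun w => \sum_i a t i w * X (t, i) w) in PA.
set V := (fun w => \sum_i Q j i * X (t, i) w) in PV.
have Pyl : polyspan X (past t.+1) (y t j).
  by apply: polyspan_catl => //; exact: (past_uniq t.+1).
have uS := past_uniq t.+1; have u0 := past_uniq t.
transitivity (Esp (fun w => y t j w ^+ 2 - 2 * eta * (y t j w * (A w * V w))
    + eta ^+ 2 * (A w ^+ 2 * V w ^+ 2))).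
  by apply: eq_Rintegral => w _; rewrite yS -/(A w) -/(V w); ring.
have P1 : polyspan X (past t.+1) (fun w => y t j w ^+ 2) by exact: polyspanX.
have P2 : polyspan X (past t.+1) (fun w => y t j w * (A w * V w)).
  by apply: polyspanM => //; exact: polyspanM.
have P3 : polyspan X (past t.+1) (fun w => A w ^+ 2 * V w ^+ 2).
  by apply: polyspanM; exact: polyspanX.
rewrite (RintegralD_poly indX normX uS); last 2 first.
- by apply: polyspanB => //; exact: polyspanZ.
- exact: polyspanZ.
rewrite (RintegralB_poly indX normX uS)//; last exact: polyspanZ.
rewrite !(RintegralZ_poly indX normX _ uS)//.
rewrite (Rintegral_form2 indX normX (@uinj t) uS (Q j) (Pa t) (Py t j)).
rewrite (Rintegral_form4 indX normX (@uinj t) uS (Q j) (Pa t)) Q2 mul1r.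
have PY2 k : polyspan X (past t) (fun w => y t k w ^+ 2) by exact: polyspanX.
have -> : Esp (fun w => \sum_i a t i w ^+ 2) = \sum_k lam k ^+ 2 * Esp (fun w => y t k w ^+ 2).
  under eq_Rintegral do rewrite a2E.
  rewrite (Rintegral_sum_poly indX normX u0); last by move=> k; exact: polyspanZ.
  by apply: eq_bigr => k _; rewrite (RintegralZ_poly indX normX _ u0).
have -> : Esp (fun w => y t j w * (\sum_i a t i w * Q j i)) = lam j * Esp (fun w => y t j w ^+ 2).
  under eq_Rintegral do rewrite avE mulrCA -expr2.
  by rewrite (RintegralZ_poly indX normX _ u0).
have -> : Esp (fun w => (\sum_i a t i w * Q j i) ^+ 2) = lam j ^+ 2 * Esp (fun w => y t j w ^+ 2).
  under eq_Rintegral do rewrite avE exprMn.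
  by rewrite (RintegralZ_poly indX normX _ u0).
ring.
Qed.

Let Ecst c : Esp (fun=> c) = c.
Proof. by rewrite Rintegral_cst//; have /= -> := @probability_setT _ _ _ P; rewrite mulr1. Qed.

Let c0 j := ((x0 - xstar) *m Q^T) ord0 j.

Lemma mean_zo_err t :
  \sum_(i < n) fine ('E_P[fun w => zo_err H xstar fstar eta mu g x0 t w ord0 i]) ^+ 2 =
  \sum_(j < n) ((1 - eta * lam j) ^+ t * c0 j) ^+ 2.
Proof.
have Ey j : Esp (y t j) = (1 - eta * lam j) ^+ t * c0 j.
  elim: t => [|t IH]; last by rewrite mean_step IH exprS mulrA.
  transitivity (Esp (fun=> c0 j)); first by [].
  by rewrite Ecst expr0 mul1r.
pose m : 'rV[R]_n := \row_j Esp (y t j).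
have Ee i : fine ('E_P[fun w => zo_err H xstar fstar eta mu g x0 t w ord0 i]) = (m *m Q) ord0 i.
  rewrite unlock; transitivity (Esp (fun w => \sum_j Q j i * y t j w)).
    apply: eq_Rintegral => w _; rewrite -/(e t w) eE mxE; apply: eq_bigr => j _.
    by rewrite mxE mulrC.
  rewrite (Rintegral_sum_poly indX normX (past_uniq t)); last by move=> j; exact: polyspanZ.
  rewrite mxE; apply: eq_bigr => j _.
  by rewrite (RintegralZ_poly indX normX _ (past_uniq t))// mxE mulrC.
transitivity ((m *m Q *m (m *m Q)^T) ord0 ord0).
  by rewrite [RHS]mxE; apply: eq_bigr => i _; rewrite Ee [_^T _ _]mxE expr2.
rewrite trmx_mul -mulmxA (mulmxA Q) QQ mul1mx mxE; apply: eq_bigr => j _.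
by rewrite !mxE Ey expr2.
Qed.

Lemma mean_square_zo_err t :
  ('E_P[fun w => (\sum_(i < n) zo_err H xstar fstar eta mu g x0 t w ord0 i ^+ 2)%R] =
   (\sum_(j < n) ms_iter lam eta (fun j => c0 j ^+ 2) t j)%:E)%E.
Proof.
have Ey j : Esp (fun w => y t j w ^+ 2) = ms_iter lam eta (fun j => c0 j ^+ 2) t j.
  elim: t j => [|t IH] j; last by rewrite ms_step IH; under eq_bigr do rewrite IH.
  exact: (Ecst (c0 j ^+ 2)).
have PS : polyspan X (past t) (fun w => \sum_j y t j w ^+ 2).
  by apply: polyspan_sum => j; exact: polyspanX.
have -> : (fun w => \sum_(i < n) zo_err H xstar fstar eta mu g x0 t w ord0 i ^+ 2) =
    (fun w => \sum_j y t j w ^+ 2).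
  apply/funext => w; transitivity ((e t w *m (e t w)^T) ord0 ord0).
    by rewrite [RHS]mxE; apply: eq_bigr => i _; rewrite [_^T _ _]mxE expr2.
  rewrite eE trmx_mul -mulmxA (mulmxA Q) QQ mul1mx mxE; apply: eq_bigr => j _.
  by rewrite !mxE expr2.
have IS := polyspan_integrable indX normX (past_uniq t) PS.
rewrite unlock -[LHS]fineK; last exact: integrable_fin_num.
congr EFin; rewrite -/(Rintegral _ _ _).
rewrite (Rintegral_sum_poly indX normX (past_uniq t)); last by move=> j; exact: polyspanX.
by apply: eq_bigr => j _; rewrite Ey.
Qed.

End dynamics.

(** * The second-moment recursion *)

Lemma expr_unbounded (R : realType) (q M : R) : 1 < q -> exists t, M < q ^+ t.
Proof.
move=> q1; have bern t : 1 + (q - 1) * t%:R <= q ^+ t.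
  elim: t => [|t IH]; first by rewrite mulr0 addr0 expr0.
  rewrite exprS -natr1; have : 0 <= t%:R :> R by []. 
  move: (t%:R) (q ^+ t) IH => a b IH a0.
  have := mulr_ge0 (sqr_ge0 (q - 1)) a0; have := ler_wpM2l (ltW (lt_trans ltr01 q1)) IH.
  by lra.
exists (Num.truncn (`|M| / (q - 1))).+1.
apply: lt_le_trans (bern _); have := truncnS_gt (`|M| / (q - 1)).
rewrite ltr_pdivrMr ?subr_gt0// mulrC => h.
by have := ler_norm M; lra.
Qed.

(** Membership of [b] is left open, so stability at the critical step size is never examined. *)
Lemma sup_initial_segment (R : realType) (A : set R) (b : R) : 0 < b ->
  (forall x, 0 < x -> x < b -> A x) -> (forall x, A x -> x <= b) -> sup A = b.
Proof.
move=> b0 Ain Aub.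
have hA : has_sup A.
  by split; [exists (b / 2); apply: Ain; lra|exists b].
have le : sup A <= b by apply: ge_sup => //; case: hA.
apply/eqP; rewrite eq_le le /= leNgt; apply/negP => lt.
have h2 : b / 2 <= sup A by apply: sup_upper_bound => //; apply: Ain; lra.
have : (sup A + b) / 2 <= sup A by apply: sup_upper_bound => //; apply: Ain; lra.
lra.
Qed.

Section mean_square_recursion.
Context {R : realType} {n : nat} (lam : 'I_n -> R) (lmax : R) (k : 'I_n).
Hypothesis lam0 : forall i, 0 <= lam i.
Hypothesis lamle : forall i, lam i <= lmax.
Hypothesis lamk : lam k = lmax.
Hypothesis lmax0 : 0 < lmax.

Definition crit_sum (eta : R) := \sum_i (eta * lam i) / (2 * (1 - eta * lam i)).

Lemma crit_term_lt1 eta i : 0 < eta -> eta * lmax < 1 -> eta * lam i < 1.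
Proof. by move=> e0; apply: le_lt_trans; rewrite ler_wpM2l// ltW. Qed.

Section fixed_eta.
Variables (eta : R) (s0 : 'I_n -> R).
Hypothesis eta0 : 0 < eta.
Hypothesis s00 : forall j, 0 <= s0 j.
Local Notation s t j := (ms_iter lam eta s0 t j).
Local Notation L t := (\sum_k lam k ^+ 2 * s t k).

Lemma ms_iter_ge0 t j : 0 <= s t j.
Proof.
elim: t j => [|t IH] j //=; rewrite addr_ge0// mulr_ge0 ?sqr_ge0//.
  by have := sqr_ge0 (1 - eta * lam j); have := sqr_ge0 (eta * lam j); nra.
by apply: sumr_ge0 => i _; rewrite mulr_ge0 ?sqr_ge0.
Qed.

Lemma ms_iter_drive_ge0 t : 0 <= L t.
Proof. by apply: sumr_ge0 => i _; rewrite mulr_ge0 ?sqr_ge0 ?ms_iter_ge0. Qed.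

(* [2 eta lam^2 = 2 eta lam (1 - eta lam) W], so the weights [W] absorb the contraction of
   each coordinate into the common drive [L]. *)
Local Notation W j := (lam j / (1 - eta * lam j)).

Lemma lyapunov_step t : eta * lmax < 1 ->
  \sum_j W j * s t.+1 j = \sum_j W j * s t j + 2 * eta * (crit_sum eta - 1) * L t.
Proof.
move=> el.
have SW : eta * \sum_j W j = 2 * crit_sum eta.
  rewrite !mulr_sumr; apply: eq_bigr => j _.
  by field; have := crit_term_lt1 j eta0 el; rewrite subr_eq0 => /lt_eqF; rewrite eq_sym => ->.
transitivity (\sum_j (W j * s t j - 2 * eta * (lam j ^+ 2 * s t j) + W j * (eta ^+ 2 * L t))).
  apply: eq_bigr => j _ /=.
  by field; have := crit_term_lt1 j eta0 el; rewrite subr_eq0 => /lt_eqF; rewrite eq_sym => ->.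
rewrite big_split big_split /= sumrN -mulr_sumr -mulr_suml.
have -> : (\sum_j W j) * (eta ^+ 2 * L t) = (eta * \sum_j W j) * (eta * L t) by ring.
rewrite SW; ring.
Qed.

(** For [x = eta lam_j] in [[0, 1)] the own factor [1 - 2x + 2x^2] is at most 1, so growth comes
    only from the common drive, received by [n] coordinates. *)
Lemma total_step t : eta * lmax < 1 ->
  \sum_j s t.+1 j <= \sum_j s t j + eta ^+ 2 * n%:R * L t.
Proof.
move=> el.
have -> : eta ^+ 2 * n%:R * L t = \sum_(j < n) eta ^+ 2 * L t.
  by rewrite sumr_const card_ord -mulr_natr; ring.
rewrite -big_split /=; apply: ler_sum => j _; rewrite lerD2r.
have := crit_term_lt1 j eta0 el; have := mulr_ge0 (ltW eta0) (lam0 j).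
move: (eta * lam j) (ms_iter_ge0 t j) => x sj x0 x1.
by rewrite ler_piMl//; nra.
Qed.

Lemma ms_iter_bounded : eta * lmax < 1 -> crit_sum eta < 1 ->
  exists M, forall t, \sum_j s t j <= M.
Proof.
(* Since [W j] vanishes when [lam j = 0], the weighted sum does not control the kernel of the
   matrix. [K] is the ratio of the growth [eta^2 n L] of the plain sum to the loss [2 eta (1 - S) L]
   of the weighted one. *)
move=> el S1; pose K := eta * n%:R / (2 * (1 - crit_sum eta)).
have K0 : 0 <= K by rewrite divr_ge0// ?mulr_ge0// ?ltW// subr_gt0.
pose V t := \sum_j s t j + K * \sum_j W j * s t j.
have Vdec t : V t.+1 <= V t.
  rewrite /V lyapunov_step//; have := total_step t el.
  have -> : eta ^+ 2 * n%:R * L t = - (K * (2 * eta * (crit_sum eta - 1) * L t)).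
    by rewrite /K; field; rewrite subr_eq0 gt_eqF.
  by lra.
exists (V 0%N) => t; apply: (@le_trans _ _ (V t)).
  rewrite lerDl mulr_ge0// sumr_ge0// => j _; rewrite mulr_ge0 ?ms_iter_ge0// divr_ge0//.
  by rewrite subr_ge0 ltW// crit_term_lt1.
by elim: t => // t IH; exact: le_trans (Vdec t) IH.
Qed.

Lemma ms_iter_supercritical : eta * lmax < 1 -> 1 < crit_sum eta -> 0 < s0 k ->
  forall M, exists t, M < \sum_j s t j.
Proof.
move=> el S1 sk M.
have W0 j : 0 <= W j by rewrite divr_ge0// subr_ge0 ltW// crit_term_lt1.
(* An upper bound for all the ratios [W j / lam j ^+ 2] at once, turning a gain proportional to [L]
   into one proportional to [V]. If [lam j = 0] the inverse is 0 by convention, and [W j = 0]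
   too. *)
pose C := \sum_j (lam j * (1 - eta * lam j))^-1.
pose V t := \sum_j W j * s t j.
have C_ge j : (lam j * (1 - eta * lam j))^-1 <= C.
  rewrite /C (bigD1 j)//= lerDl sumr_ge0// => i _; rewrite invr_ge0 mulr_ge0//.
  by rewrite subr_ge0 ltW// crit_term_lt1.
have VL t : V t <= C * L t.
  rewrite mulr_sumr; apply: ler_sum => j _; rewrite mulrA ler_wpM2r ?ms_iter_ge0//.
  have [->|lj] := eqVneq (lam j) 0; first by rewrite mul0r expr0n mulr0.
  have j1 := crit_term_lt1 j eta0 el.
  have -> : W j = (lam j * (1 - eta * lam j))^-1 * lam j ^+ 2.
    by field; rewrite lj subr_eq0 eq_sym lt_eqF.
  by rewrite ler_wpM2r ?sqr_ge0.
have V0 : 0 < V 0%N.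
  rewrite /V (bigD1 k)//= ltr_pwDl//.
    by rewrite mulr_gt0// divr_gt0 ?lamk// subr_gt0.
  by rewrite sumr_ge0// => j _; rewrite mulr_ge0.
have C0 : 0 < C.
  rewrite ltNge; apply/negP => C0; have := VL 0%N; have := ms_iter_drive_ge0 0.
  by move: (L 0%N) V0 => l; nra.
pose q := 1 + 2 * eta * (crit_sum eta - 1) / C.
have r0 : 0 < 2 * eta * (crit_sum eta - 1) by rewrite !mulr_gt0// subr_gt0.
have q1 : 1 < q by rewrite ltrDl divr_gt0.
have Vgrow t : q ^+ t * V 0%N <= V t.
  elim: t => [|t IH]; first by rewrite expr0 mul1r.
  rewrite exprS -mulrA; apply: (@le_trans _ _ (q * V t)).
    by rewrite ler_wpM2l// ltW// (lt_trans _ q1).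
  rewrite /V lyapunov_step// -/(V t) /q mulrDl mul1r lerD2l -mulrA ler_wpM2l ?(ltW r0)//.
  by rewrite ler_pdivrMl.
have VS t : V t <= (\sum_j W j) * \sum_j s t j.
  rewrite mulr_sumr; apply: ler_sum => j _; rewrite ler_wpM2r ?ms_iter_ge0//.
  by rewrite (bigD1 j)//= lerDl sumr_ge0.
(* Growth is known for [V] only, so the target [M] is rescaled by the total weight and by the
   initial value of [V]. *)
have [t ht] := expr_unbounded ((\sum_j W j) * M / V 0%N) q1.
exists t; rewrite ltNge; apply/negP => hM.
move: ht; rewrite ltr_pdivrMr// => ht.
have WS : 0 <= \sum_j W j by apply: sumr_ge0.
have := ler_wpM2l WS hM; have := VS t; have := Vgrow t; lra.
Qed.

(** With [x = eta * lmax], coordinate [k] is multiplied by at least [1 - 2x + 3x^2], its share of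
    the drive included; this is at least 2 because [3x^2 - 2x - 1 = (3x + 1)(x - 1)]. *)
Lemma ms_iter_large_step : 1 <= eta * lmax -> 0 < s0 k ->
  forall M, exists t, M < \sum_j s t j.
Proof.
move=> el sk M.
have grow t : 2 ^+ t * s0 k <= s t k.
  elim: t => [|t IH]; first by rewrite expr0 mul1r.
  have Lk : lam k ^+ 2 * s t k <= L t.
    by rewrite (bigD1 k)//= lerDl sumr_ge0// => j _; rewrite mulr_ge0 ?sqr_ge0 ?ms_iter_ge0.
  rewrite exprS -mulrA; apply: (@le_trans _ _ (2 * s t k)); first by rewrite ler_wpM2l.
  have := ler_wpM2l (sqr_ge0 eta) Lk; rewrite mulrA -exprMn /= lamk => {}Lk.
  apply: le_trans (lerD (lexx _) Lk); rewrite -mulrDl ler_wpM2r ?ms_iter_ge0//.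
  by move: (eta * lmax) el => x x1; nra.
have [t ht] := expr_unbounded (M / s0 k) (ltr1n R 2 : 1 < 2 :> R).
exists t; apply: (@lt_le_trans _ _ (2 ^+ t * s0 k)); first by rewrite -ltr_pdivrMr.
apply: (le_trans (grow t)); rewrite (bigD1 k)//= lerDl sumr_ge0// => j _.
exact: ms_iter_ge0.
Qed.

End fixed_eta.

Lemma crit_sum_increasing e1 e2 : 0 < e1 -> e1 < e2 -> e2 * lmax < 1 ->
  crit_sum e1 < crit_sum e2.
Proof.
move=> e10 e12 e2l; have e20 := lt_trans e10 e12.
have e1l : e1 * lmax < 1 by apply: le_lt_trans e2l; rewrite ler_wpM2r ?ltW.
have term i : (e2 * lam i) / (2 * (1 - e2 * lam i)) - (e1 * lam i) / (2 * (1 - e1 * lam i)) =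
    (e2 - e1) * lam i / (2 * (1 - e2 * lam i) * (1 - e1 * lam i)).
  have h1 := crit_term_lt1 i e10 e1l; have h2 := crit_term_lt1 i e20 e2l.
  by field; rewrite !subr_eq0 !(eq_sym 1) !lt_eqF.
rewrite -subr_gt0 -sumrB (bigD1 k)//= ltr_pwDl//.
  by rewrite term lamk divr_gt0 ?mulr_gt0 ?subr_gt0.
apply: sumr_ge0 => i _; rewrite term divr_ge0 ?mulr_ge0 ?subr_ge0 ?(ltW e12)//.
- by rewrite ltW// crit_term_lt1.
- by rewrite ltW// crit_term_lt1.
Qed.

Lemma crit_sum_root : exists eta, [/\ 0 < eta, eta * lmax < 1 & crit_sum eta = 1].
Proof.
(* At [eta * lmax = 2/3] the term of index [k] alone equals 1, so the intermediate value theorem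
   applies on [[0, b]], well before the pole. *)
pose b := 2 / (3 * lmax).
have b0 : 0 < b by rewrite divr_gt0 ?mulr_gt0.
have bl : b * lmax = 2 / 3 by rewrite /b; field; rewrite gt_eqF.
have S0 : crit_sum 0 = 0 by rewrite /crit_sum big1// => i _; rewrite !mul0r.
have Sb : 1 <= crit_sum b.
  rewrite /crit_sum (bigD1 k)//= lamk bl (_ : 2 / 3 / (2 * (1 - 2 / 3)) = 1); last by field.
  rewrite lerDl sumr_ge0// => i _; apply: divr_ge0; first by rewrite mulr_ge0// ltW.
  by rewrite mulr_ge0// subr_ge0 ltW// crit_term_lt1// bl; lra.
have lt1 x i : 0 <= x -> x <= b -> x * lam i < 1.
  move=> x0 xb; apply: (@le_lt_trans _ _ (b * lmax)); first exact: ler_pM.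
  by rewrite bl; lra.
have cS : {within `[0, b], continuous crit_sum}.
  apply: continuous_in_subspaceT => x; rewrite inE /= in_itv /= => /andP[x0 xb].
  have cr (r : seq 'I_n) : (\sum_(i <- r) (y * lam i) / (2 * (1 - y * lam i))) @[y --> x] -->
      \sum_(i <- r) (x * lam i) / (2 * (1 - x * lam i)).
    elim: r => [|i r IH]; first by under eq_fun do rewrite big_nil; rewrite big_nil; exact: cvg_cst.
    under eq_fun do rewrite big_cons; rewrite big_cons; apply: cvgD; last exact: IH.
    have cl : (y * lam i) @[y --> x] --> x * lam i by apply: cvgM; [exact: cvg_id|exact: cvg_cst].
    apply: cvgM => //; apply: cvgV.
      by rewrite mulf_neq0// subr_eq0 gt_eqF// lt1.
    by apply: cvgM; [exact: cvg_cst|apply: cvgB; [exact: cvg_cst|exact: cl]].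
  exact: cr.
have [|eta] := @IVT _ crit_sum 0 b 1 (ltW b0) cS.
  by rewrite S0 ge_min ler01 /= le_max Sb orbT.
rewrite in_itv /= => /andP[e0 eb] Se; exists eta; split => //.
  rewrite lt_neqAle e0 andbT; apply/eqP => e00; move: Se; rewrite -e00 S0.
  by move/eqP; rewrite eq_sym oner_eq0.
by rewrite -lamk lt1.
Qed.

End mean_square_recursion.

(** * Critical step sizes *)

Lemma lambda_maxE (R : realType) n (lam : 'I_n.+1 -> R) : 0 <= lam ord0 ->
  (forall i j : 'I_n.+1, (i <= j)%N -> lam j <= lam i) -> lambda_max lam = lam ord0.
Proof.
move=> l0 sl; apply/eqP; rewrite eq_le; apply/andP; split.
  by apply: bigmax_le => // i _; exact: sl.
exact: le_bigmax_cond.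
Qed.

Section critical_step_sizes.
Context {R : realType} {n : nat} dT {T : measurableType dT} (P : probability T R).
Variables (g : nat -> 'I_n -> T -> R) (H Q : 'M[R]_n) (lam : 'I_n -> R) (lmax : R) (k : 'I_n).
Variables (xstar : 'rV[R]_n) (fstar mu : R).
Hypothesis gG : iid_std_gaussian_vectors P g.
Hypothesis Hs : H^T = H.
Hypothesis QQ : Q *m Q^T = 1%:M.
Hypothesis QH : Q *m H *m Q^T = diag_mx (\row_i lam i).
Hypothesis mu0 : 0 < mu.
Hypothesis lam0 : forall i, 0 <= lam i.
Hypothesis lamle : forall i, lam i <= lmax.
Hypothesis lamk : lam k = lmax.
Hypothesis lmax0 : 0 < lmax.

(** The destabilizing start is the minimizer displaced by the unit eigenvector of [lmax]: only
    coordinate [k] is excited. *)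
Let eigen_coord j : ((xstar + row k Q - xstar) *m Q^T) ord0 j = (j == k)%:R.
Proof.
by rewrite addrC addKr -row_mul QQ !mxE eq_sym.
Qed.

(** While [eta * lmax < 2] every factor [1 - eta lam_j] lies in [[-1, 1]]; beyond 2 the one of index
    [k] has modulus above 1. *)
Lemma eta_crit_meanE : eta_crit_mean P H xstar fstar mu g = 2 / lmax.
Proof.
apply: sup_initial_segment; first by rewrite divr_gt0.
- move=> eta e0; rewrite ltr_pdivlMr// => el; split => // x0.
  exists (Num.sqrt (\sum_j (((x0 - xstar) *m Q^T) ord0 j) ^+ 2)) => t.
  rewrite ler_wsqrtr// (mean_zo_err _ _ _ gG Hs QQ QH mu0); apply: ler_sum => j _.
  rewrite exprMn -exprM mulnC exprM ler_piMl ?sqr_ge0// exprn_ile1 ?sqr_ge0//.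
  have := ler_wpM2l (ltW e0) (lamle j); have := mulr_ge0 (ltW e0) (lam0 j).
  by move: (eta * lam j) (eta * lmax) el => x y *; nra.
- move=> eta [e0 st]; rewrite leNgt; apply/negP; rewrite ltr_pdivrMr// => el.
  have [M hM] := st (xstar + row k Q).
  have q1 : 1 < (1 - eta * lmax) ^+ 2.
    by move: (eta * lmax) el => x x2; nra.
  have [t] := expr_unbounded (M ^+ 2) q1; apply/negP; rewrite -leNgt.
  have := hM t; rewrite (mean_zo_err _ _ _ gG Hs QQ QH mu0) (bigD1 k)//= eigen_coord eqxx mulr1.
  rewrite big1 ?addr0 => [|j jk]; last by rewrite eigen_coord (negbTE jk) mulr0 expr0n.
  rewrite lamk sqrtr_sqr => h; rewrite -exprM mulnC exprM -real_normK ?num_real//.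
  by rewrite ler_sqr ?nnegrE// (le_trans _ h).
Qed.

Lemma eta_crit_msE eta : 0 < eta -> eta * lmax < 1 -> crit_sum lam eta = 1 ->
  eta_crit_ms P H xstar fstar mu g = eta.
Proof.
move=> e0 el Se; apply: sup_initial_segment => //.
- move=> e' e'0 e'e; split => // x0.
  have e'l : e' * lmax < 1 by apply: lt_trans el; rewrite ltr_pM2r.
  have S1 : crit_sum lam e' < 1 by rewrite -Se; exact: (crit_sum_increasing lam0 lamle lamk lmax0).
  have [|M hM] := @ms_iter_bounded _ _ lam lmax lam0 lamle e'
    (fun j => ((x0 - xstar) *m Q^T) ord0 j ^+ 2) e'0 _ e'l S1.
    by move=> j; exact: sqr_ge0.
  by exists M => t; rewrite (mean_square_zo_err _ _ _ gG Hs QQ QH mu0) lee_fin.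
- move=> e' [e'0 st]; rewrite leNgt; apply/negP => ee'.
  have [M hM] := st (xstar + row k Q).
  pose s0 (j : 'I_n) := (((xstar + row k Q - xstar) *m Q^T) ord0 j) ^+ 2.
  have s00 j : 0 <= s0 j by exact: sqr_ge0.
  have sk : 0 < s0 k by rewrite /s0 eigen_coord eqxx expr1n.
  have [t] : exists t, M < \sum_j ms_iter lam e' s0 t j.
    (* Past the pole of [crit_sum] the weights no longer help, and the top coordinate takes over. *)
    have [e'l|e'l] := ltP (e' * lmax) 1.
      apply: (ms_iter_supercritical lam0 lamle lamk lmax0 e'0 s00 e'l) => //.
      by rewrite -Se; exact: (crit_sum_increasing lam0 lamle lamk lmax0).
    exact: (ms_iter_large_step lamk s00 e'l sk).
  apply/negP; rewrite -leNgt -lee_fin.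
  by have := hM t; rewrite (mean_square_zo_err _ _ _ gG Hs QQ QH mu0).
Qed.

End critical_step_sizes.

(** With [x = eta lam_i] and [y = eta * lmax], both bounds are termwise: [x <= x / (1 - x)] gives
    the upper one, and [(1 - y) x / (1 - x) <= x] the lower one. *)
Lemma crit_sum_bounds (R : realType) n (lam : 'I_n -> R) (lmax eta : R) :
  (forall i, 0 <= lam i) -> (forall i, lam i <= lmax) ->
  0 < lmax -> 0 < eta -> eta * lmax < 1 -> crit_sum lam eta = 1 ->
  2 / (\sum_i lam i + 2 * lmax) <= eta <= 2 / \sum_i lam i.
Proof.
move=> lam0 lamle lmax0 e0 el Se.
have lt1 i := crit_term_lt1 lamle i e0 el.
have S0 : 0 <= \sum_i lam i by exact: sumr_ge0.
have Sgt0 : 0 < \sum_i lam i.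
  rewrite lt_neqAle S0 andbT eq_sym; apply/eqP => /eqP; rewrite psumr_eq0// => /allP h.
  have : crit_sum lam eta = 0.
    by rewrite /crit_sum big1// => i _; have /eqP -> := h i (mem_index_enum _); rewrite mulr0 mul0r.
  by rewrite Se => /eqP; rewrite oner_eq0.
have up : eta * \sum_i lam i <= 2.
  have -> : 2 = 2 * crit_sum lam eta by rewrite Se mulr1.
  rewrite /crit_sum !mulr_sumr; apply: ler_sum => i _.
  have := lt1 i; have := mulr_ge0 (ltW e0) (lam0 i); move: (eta * lam i) => x x0 x1.
  have -> : 2 * (x / (2 * (1 - x))) = x / (1 - x) by field; rewrite subr_eq0 gt_eqF.
  by rewrite ler_pdivlMr ?subr_gt0//; nra.
have lo : 2 * (1 - eta * lmax) <= eta * \sum_i lam i.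
  have -> : 2 * (1 - eta * lmax) = 2 * (1 - eta * lmax) * crit_sum lam eta by rewrite Se mulr1.
  rewrite /crit_sum !mulr_sumr; apply: ler_sum => i _.
  have := lt1 i; have := mulr_ge0 (ltW e0) (lam0 i); have := ler_wpM2l (ltW e0) (lamle i).
  move: (eta * lam i) (eta * lmax) el => x y y1 xy x0 x1.
  rewrite mulrA ler_pdivrMr ?mulr_gt0 ?subr_gt0//; nra.
apply/andP; split.
  by rewrite ler_pdivrMr; [lra|rewrite addr_gt0// mulr_gt0].
by rewrite ler_pdivlMr.
Qed.

Theorem theorem4p7 (R : realType) (n : nat) (f : 'rV[R]_n -> R) (xstar : 'rV[R]_n)
  (H : 'M[R]_n) (lam : 'I_n -> R)
  (dT : measure_display) (T : measurableType dT) (P : probability T R)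
  (g : nat -> 'I_n -> T -> R) (mu : R) :
  local_minimizer f xstar ->
  twice_differentiable_near f xstar ->
  H = Hessian f xstar ->
  psd H -> H != 0 ->
  sorted_eigenvalues H lam ->
  (forall i, 0 <= lam i) ->
  0 < mu ->
  iid_std_gaussian_vectors P g ->
  let lmax := lambda_max lam in
  let eta_ms := eta_crit_ms P H xstar (f xstar) mu g in
  eta_crit_mean P H xstar (f xstar) mu g = 2 / lmax /\
  (0 < eta_ms /\ eta_ms * lmax < 1 /\
   \sum_(i < n) (eta_ms * lam i) / (2 * (1 - eta_ms * lam i)) = 1) /\
  (forall eta : R, 0 < eta -> eta * lmax < 1 ->
     \sum_(i < n) (eta * lam i) / (2 * (1 - eta * lam i)) = 1 -> eta = eta_ms) /\
  2 / (\tr H + 2 * lmax) <= eta_ms <= 2 / \tr H.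
Proof.
move=> _ _ _ [Hs _] H0 [chH sl] lam0 mu0 gG lmax eta_ms.
(* A nonzero matrix has positive size, so [ord0] exists and indexes the top eigenvalue. *)
case: n => [|n] in f xstar H lam g Hs H0 chH sl lam0 gG lmax eta_ms *.
  by move: H0; rewrite (flatmx0 H) eqxx.
have [Q [QQ QH]] := spectral_split Hs chH.
have QtQ : Q^T *m Q = 1%:M by exact: mulmx1C.
have HE : H = Q^T *m diag_mx (\row_i lam i) *m Q.
  by rewrite -QH !mulmxA QtQ mul1mx -mulmxA QtQ mulmx1.
have lamk : lam ord0 = lmax by rewrite /lmax lambda_maxE.
have lamle i : lam i <= lmax by rewrite -lamk sl.
have lmax0 : 0 < lmax.
  rewrite lt_neqAle -{2}lamk lam0 andbT; apply/eqP => l0.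
  move: H0; rewrite HE (_ : diag_mx _ = 0) ?mulmx0 ?mul0mx ?eqxx//.
  apply/matrixP => i j; rewrite !mxE (_ : lam i = 0) ?mul0rn//.
  by apply/eqP; rewrite eq_le lam0 andbT l0 lamle.
have trH : \tr H = \sum_i lam i.
  rewrite HE -mulmxA mxtrace_mulC -mulmxA QQ mulmx1 mxtrace_diag.
  by apply: eq_bigr => i _; rewrite mxE.
(* Every solution of the critical equation equals the supremum: this gives uniqueness, and, once one
   solution exists, the equation for [eta_ms] itself. *)
have msE eta : 0 < eta -> eta * lmax < 1 -> crit_sum lam eta = 1 -> eta_ms = eta.
  exact: (eta_crit_msE xstar (f xstar) gG Hs QQ QH mu0 lam0 lamle lamk lmax0).
have [eta [e0 el Se]] := crit_sum_root lam0 lamle lamk lmax0.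
split; first exact: (eta_crit_meanE xstar (f xstar) gG Hs QQ QH mu0 lam0 lamle lamk lmax0).
split; first by rewrite (msE eta).
split; first by move=> e e_gt0 e_lt S1; rewrite (msE e).
by rewrite (msE eta)// trH; exact: crit_sum_bounds.
Qed.
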